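(* For each positive odd integer $l$ let $n(l)$ be the number of isomorphism classes of $l$-reflexive polygons. Then, for odd $l$ with $1\le l<60$: $n(1)=16$, $n(3)=1$, $n(5)=12$, $n(7)=29$, $n(9)=1$, $n(11)=61$, $n(13)=81$, $n(15)=1$, $n(17)=113$, $n(19)=131$, $n(21)=2$, $n(23)=163$, $n(25)=50$, $n(27)=2$, $n(29)=215$, $n(31)=233$, $n(33)=2$, $n(35)=34$, $n(37)=285$, $n(39)=3$, $n(41)=317$, $n(43)=335$, $n(45)=2$, $n(47)=367$, $n(49)=182$, $n(51)=3$, $n(53)=419$, $n(55)=72$, $n(57)=4$, $n(59)=469$.
   Context: Let $N\cong\mathbb{Z}^2$ be a lattice with dual lattice $M=\mathrm{Hom}(N,\mathbb{Z})$. A polygon here is a 2-dimensional convex lattice polytope $P\subset N\otimes_{\mathbb{Z}}\mathbb{Q}$, i.e. its vertices lie in $N$. A nonzero lattice point $x$ is primitive if the segment from $\mathbf{0}$ to $x$ contains no lattice points other than its endpoints. If $P$ has the origin in its interior and $F$ is a facet (edge) of $P$, the primitive outer normal of $F$ is the unique primitive $u_F\in M$ such that $F=\{x\in P\mid\langle u_F,x\rangle=l_F\}$ for some positive integer $l_F$, called the local index of $F$. $P$ is $l$-reflexive if it contains the origin in its interior, all its vertices are primitive, and $l_F=l$ for every facet $F$. Two lattice polytopes $P\subset N_{\mathbb{Q}}$ and $P'\subset N'_{\mathbb{Q}}$ are isomorphic if there is an affine lattice isomorphism $N\cong N'$ mapping the vertex set of $P$ onto that of $P'$. *)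

(* Defs.v *)
From mathcomp Require Import all_boot all_order all_algebra.
From mathcomp Require Import boolp classical_sets functions cardinality.

Set Implicit Arguments.
Unset Strict Implicit.
Unset Printing Implicit Defensive.

Import Order.TTheory GRing.Theory Num.Theory.

Local Open Scope classical_set_scope.
Local Open Scope ring_scope.

(* The lattice is N = Z^n, written as integer row vectors, and N_Q = Q^n.  The
   dual lattice M is also written as integer row vectors, in the dual basis, so
   that the pairing of M_Q with N_Q is the dot product. *)

Definition lat {m n : nat} (x : 'M[int]_(m, n)) : 'M[rat]_(m, n) :=
  map_mx intr x.

Definition pairing {n : nat} (u x : 'rV[rat]_n) : rat :=
  \sum_(i < n) u 0 i * x 0 i.

Definition segment {n : nat} (x y : 'rV[rat]_n) : set 'rV[rat]_n :=
  [set (1 - t) *: x + t *: y | t in [set t : rat | 0 <= t <= 1]].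

Definition primitive {n : nat} (x : 'rV[int]_n) : Prop :=
  x <> 0 /\ forall y : 'rV[int]_n, segment 0 (lat x) (lat y) -> y = 0 \/ y = x.

Definition simplex {k : nat} : set 'rV[rat]_k :=
  [set w | (forall i, 0 <= w 0 i) /\ \sum_(i < k) w 0 i = 1].

(* convex hull of the rows of A *)
Definition conv_rows {k n : nat} (A : 'M[rat]_(k, n)) : set 'rV[rat]_n :=
  [set w *m A | w in simplex].

Definition polytope {n : nat} (P : set 'rV[rat]_n) : Prop :=
  exists (k : nat) (A : 'M[rat]_(k, n)), P = conv_rows A.

(* extreme points *)
Definition vertices {n : nat} (P : set 'rV[rat]_n) : set 'rV[rat]_n :=
  [set v | P v /\ forall (x y : 'rV[rat]_n) (t : rat), P x -> P y ->
             0 < t < 1 -> v = (1 - t) *: x + t *: y -> x = y].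

(* The affine span of S is x0 + (row space of A), with A of rank d. *)
Definition has_dim {n : nat} (S : set 'rV[rat]_n) (d : nat) : Prop :=
  exists (x0 : 'rV[rat]_n) (A : 'M[rat]_(d, n)),
    [/\ row_free A, S x0, forall i, S (x0 + row i A)
      & forall x, S x -> (x - x0 <= A)%MS].

Definition face {n : nat} (P F : set 'rV[rat]_n) : Prop :=
  exists (u : 'rV[rat]_n) (c : rat),
    (forall x, P x -> pairing u x <= c) /\
    F = [set x | P x /\ pairing u x = c].

(* The topology of Q^n is that of the sup norm. *)
Definition origin_in_interior {n : nat} (P : set 'rV[rat]_n) : Prop :=
  exists2 e : rat, 0 < e &
    forall x : 'rV[rat]_n, (forall i, `|x 0 i| < e) -> P x.

Definition lattice_polygon (P : set 'rV[rat]_2) : Prop :=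
  [/\ polytope P, has_dim P 2
    & forall v, vertices P v -> exists z : 'rV[int]_2, v = lat z].

Definition facet (P F : set 'rV[rat]_2) : Prop := face P F /\ has_dim F 1.

(* For a facet F of a polygon P with the origin in its interior, u is unique,
   it is the primitive outer normal of F, and l is determined by F. *)
Definition local_index (P F : set 'rV[rat]_2) (l : nat) : Prop :=
  (0 < l)%N /\
  exists u : 'rV[int]_2,
    primitive u /\ F = [set x | P x /\ pairing (lat u) x = l%:R].

Definition reflexive_polygon (l : nat) (P : set 'rV[rat]_2) : Prop :=
  [/\ lattice_polygon P, origin_in_interior P,
      forall z : 'rV[int]_2, vertices P (lat z) -> primitive z
    & forall F, facet P F -> local_index P F l].

(* The affine automorphisms of the lattice Z^2 are x |-> x A + b with A in
   GL_2(Z) and b in Z^2. *)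
Definition isomorphic (P P' : set 'rV[rat]_2) : Prop :=
  exists (A : 'M[int]_2) (b : 'rV[int]_2),
    A \in unitmx /\
    [set x *m lat A + lat b | x in vertices P] = vertices P'.

Definition iso_class (l : nat) (P : set 'rV[rat]_2) : set (set 'rV[rat]_2) :=
  [set Q | reflexive_polygon l Q /\ isomorphic P Q].

Definition iso_classes (l : nat) : set (set (set 'rV[rat]_2)) :=
  [set iso_class l P | P in [set P | reflexive_polygon l P]].

(* n(l) = k; this includes the finiteness of the number of classes. *)
Definition num_classes (l k : nat) : Prop := (iso_classes l #= `I_k)%card.

(* Main.v *)
(* Proof idea. Let P be an l-reflexive polygon. Consecutive boundary lattice
   points x, y, met while walking around P counterclockwise along its edges,
   satisfy det(x, y) = l, and three consecutive ones satisfy x + z = k y for an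
   integer k, because vertices are primitive. Hence all boundary points lie in
   the sublattice of index l spanned by two consecutive ones, and with respect to
   it P is a 1-reflexive polygon. So P is the image Q W of one of finitely many
   loops Q of boundary points, found by a search, under an integer matrix W with
   |det W| = l; conversely Q W is l-reflexive if and only if the images of the
   vertices and of the edge normals of Q are primitive. Up to a change of basis of
   Q and of Z^2 one may take Q among 16 representatives and W in Hermite normal
   form ((1, 0), (c, l)) with 0 <= c < l. Two such pairs (Q, c), (Q', c') are
   isomorphic if and only if Q = Q' and the parameters c, c' are related by the
   Moebius action modulo l of the finite automorphism group of Q, so that n(l) is
   a number of orbits, which is computed. *)

From mathcomp Require Import all_boot all_order all_algebra.
From mathcomp Require Import boolp classical_sets functions cardinality.
From mathcomp Require Import ring lra zify.
Require Import Defs.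

Set Implicit Arguments.
Unset Strict Implicit.
Unset Printing Implicit Defensive.

Import Order.TTheory GRing.Theory Num.Theory.

Local Open Scope ring_scope.

Local Notation vec2 := 'rV[rat]_2.
Local Notation pt := (int * int)%type.

(** * Plane vectors and convex hulls *)

(** The walk is built one step at a time, so a priori it is an infinite sequence in a finite set of
    lattice points, and nothing says when it closes. That it keeps meeting earlier points is enough
    to make it face every direction; convexity then bounds the multipliers [k] by 2 in absolute
    value and allows at most four equal steps in a row. A finite search applies, and it is the
    search that proves the return to the start.

    Isomorphisms pose two difficulties. They are affine maps given on vertices only, so the polygon
    must be recovered from them and translations excluded; the common value [l] of the local indices
    does the latter. And they respect [Z^2], but not obviously the sublattice of boundary points; an
    edge through a vertex shows that they do.

    Base changes send the first basis vector to a vertex, since only vertices are known to be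
    primitive; this makes the Hermite form with first row [(1, 0)] available. Each orbit is counted
    by its least parameter. *)

Definition cx (x : vec2) : rat := x 0 0.
Definition cy (x : vec2) : rat := x 0 1.
Definition vec (a b : rat) : vec2 := \row_i (if i == 0 then a else b).

Lemma vec2P (x y : vec2) : cx x = cx y -> cy x = cy y -> x = y.
Proof.
move=> h0 h1; apply/rowP=> i; case: i => [[|[|//]] hi].
- by have -> : Ordinal hi = 0 by apply/val_inj.
- by have -> : Ordinal hi = 1 by apply/val_inj.
Qed.

Lemma cx_vec a b : cx (vec a b) = a. Proof. by rewrite /cx mxE. Qed.
Lemma cy_vec a b : cy (vec a b) = b. Proof. by rewrite /cy mxE. Qed.
Lemma cxD x y : cx (x + y) = cx x + cx y. Proof. by rewrite /cx mxE. Qed.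
Lemma cyD x y : cy (x + y) = cy x + cy y. Proof. by rewrite /cy mxE. Qed.
Lemma cxN x : cx (- x) = - cx x. Proof. by rewrite /cx mxE. Qed.
Lemma cyN x : cy (- x) = - cy x. Proof. by rewrite /cy mxE. Qed.
Lemma cxZ a x : cx (a *: x) = a * cx x. Proof. by rewrite /cx mxE. Qed.
Lemma cyZ a x : cy (a *: x) = a * cy x. Proof. by rewrite /cy mxE. Qed.
Lemma cx0 : cx 0 = 0. Proof. by rewrite /cx mxE. Qed.
Lemma cy0 : cy 0 = 0. Proof. by rewrite /cy mxE. Qed.

Definition cE := (cx_vec, cy_vec, cxD, cyD, cxN, cyN, cxZ, cyZ, cx0, cy0).

Ltac vring := apply: vec2P; rewrite ?cE /=; ring.

Definition dot (u x : vec2) : rat := cx u * cx x + cy u * cy x.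
Definition det (x y : vec2) : rat := cx x * cy y - cy x * cx y.

Lemma pairingE (u x : vec2) : pairing u x = dot u x.
Proof.
rewrite /pairing big_ord_recl big_ord1 /dot /cx /cy.
by have -> : lift ord0 ord0 = 1 :> 'I_2 by apply/val_inj.
Qed.

Lemma cramer (p q x : vec2) : det p q != 0 ->
  x = (det x q / det p q) *: p + (det p x / det p q) *: q.
Proof. by move=> h; apply: vec2P; rewrite ?cE; move: h; rewrite /det => h; field. Qed.

(** A line that misses the origin meets every line through the origin at most once. Hence two points
    of an edge form a basis, and a functional is determined by its values there. *)
Lemma dot_det0 (u p q : vec2) : dot u p = dot u q -> p != q -> dot u p != 0 ->
  det p q != 0.
Proof.
move=> e npq nu; apply/eqP => d0; case/eqP: npq.
have h1 : dot u p * (cx p - cx q) = 0.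
  have -> : dot u p * (cx p - cx q) = cx p * (dot u p - dot u q) + cy u * det p q.
    by rewrite /dot /det; ring.
  by rewrite e d0; ring.
have h2 : dot u p * (cy p - cy q) = 0.
  have -> : dot u p * (cy p - cy q) = cy p * (dot u p - dot u q) - cx u * det p q.
    by rewrite /dot /det; ring.
  by rewrite e d0; ring.
by move/eqP: h1; move/eqP: h2; rewrite !mulf_eq0 (negbTE nu) !subr_eq0 /= =>
  /eqP h2 /eqP h1; apply: vec2P.
Qed.

Lemma dot_inj (u v p q : vec2) : det p q != 0 ->
  dot u p = dot v p -> dot u q = dot v q -> u = v.
Proof.
move=> d e1 e2; apply: vec2P; apply: (mulfI d).
- have -> : det p q * cx u = dot u p * cy q - dot u q * cy p by rewrite /det /dot; ring.
  by rewrite e1 e2 /det /dot; ring.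
- have -> : det p q * cy u = dot u q * cx p - dot u p * cx q by rewrite /det /dot; ring.
  by rewrite e1 e2 /det /dot; ring.
Qed.

Definition convex_pred (C : vec2 -> Prop) := forall x y t,
  C x -> C y -> 0 <= t <= 1 -> C ((1 - t) *: x + t *: y).

(** The hull as the intersection of all convex sets: a convex property passes from the generators to
    the hull without any handling of weights. *)
Definition hull (s : seq vec2) (x : vec2) : Prop :=
  forall C, convex_pred C -> (forall v, v \in s -> C v) -> C x.

Lemma hull_convex s : convex_pred (hull s).
Proof. by move=> x y t hx hy ht C cC sC; exact: (cC _ _ _ (hx _ cC sC) (hy _ cC sC) ht). Qed.

Lemma mem_hull s v : v \in s -> hull s v.
Proof. by move=> vs C _; apply. Qed.

Lemma hull_sub s (C : vec2 -> Prop) x :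
  convex_pred C -> (forall v, v \in s -> C v) -> hull s x -> C x.
Proof. by move=> cC sC; apply. Qed.

Lemma convex_le u c : convex_pred (fun x => dot u x <= c).
Proof.
move=> a b t ha hb /andP[t0 t1].
have -> : dot u ((1 - t) *: a + t *: b) = (1 - t) * dot u a + t * dot u b.
  by rewrite /dot ?cE; ring.
by nra.
Qed.

Lemma hull_le s u c x : (forall v, v \in s -> dot u v <= c) -> hull s x ->
  dot u x <= c.
Proof. by move=> h; apply: (@hull_sub s (fun x => dot u x <= c)) => //; apply: convex_le. Qed.

Lemma hull_nil x : ~ hull [::] x.
Proof. by apply. Qed.

Lemma hull_cons v s x : hull (v :: s) x ->
  x = v \/ exists t y, [/\ hull s y, 0 <= t <= 1 & x = (1 - t) *: v + t *: y].
Proof.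
pose C x := x = v \/ exists t y, [/\ hull s y, 0 <= t <= 1 & x = (1 - t) *: v + t *: y].
apply: (@hull_sub _ C); last first.
  move=> w; rewrite inE => /orP[/eqP-> | ws]; first by left.
  right; exists 1, w; split; [exact: mem_hull|by rewrite ler01 lexx|vring].
move=> a b t ha hb /andP[t0 t1].
have key t1' t2' y1 y2 : hull s y1 -> hull s y2 -> 0 <= t1' <= 1 -> 0 <= t2' <= 1 ->
    exists t' y, [/\ hull s y, 0 <= t' <= 1 &
     (1 - t) *: ((1 - t1') *: v + t1' *: y1) + t *: ((1 - t2') *: v + t2' *: y2) =
     (1 - t') *: v + t' *: y].
  move=> h1 h2 /andP[p0 p1] /andP[q0 q1].
  (* [T] is the total weight on the hull of [s]. If it vanishes, both contributions vanish and any
     point of that hull will do. *)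
  pose T := (1 - t) * t1' + t * t2'.
  have T0 : 0 <= T by rewrite /T; nra.
  have T1 : T <= 1 by rewrite /T; nra.
  have [T00|TN0] := eqVneq T 0.
    exists 0, y1; split => //.
    have e1 : (1 - t) * t1' = 0 by apply/eqP; rewrite eq_le; apply/andP; split; rewrite /T in T00; nra.
    have e2 : t * t2' = 0 by apply/eqP; rewrite eq_le; apply/andP; split; rewrite /T in T00; nra.
    have -> : (1 - t) *: ((1 - t1') *: v + t1' *: y1) + t *: ((1 - t2') *: v + t2' *: y2) =
      (1 - (1 - t) * t1' - t * t2') *: v + ((1 - t) * t1') *: y1 + (t * t2') *: y2 by vring.
    by rewrite e1 e2; vring.
  exists T, ((1 - t * t2' / T) *: y1 + (t * t2' / T) *: y2); split.
  - apply: hull_convex => //; apply/andP; split.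
      by apply: divr_ge0 => //; nra.
    by rewrite ler_pdivrMr ?lt_def ?TN0 // mul1r /T; nra.
  - by rewrite T0 T1.
  - by apply: vec2P; rewrite ?cE; move: TN0; rewrite /T => TN0; field.
have dec z : z = v \/ (exists t y, [/\ hull s y, 0 <= t <= 1 & z = (1 - t) *: v + t *: y]) ->
  (exists y, hull s y) ->
  exists t y, [/\ hull s y, 0 <= t <= 1 & z = (1 - t) *: v + t *: y].
  case=> [->|//] [y hy]; exists 0, y; split => //; vring.
have [[y0 hy0]|no] := pselect (exists y, hull s y).
  have [ta [ya [hya hta ->]]] := dec _ ha (ex_intro _ _ hy0).
  have [tb [yb [hyb htb ->]]] := dec _ hb (ex_intro _ _ hy0).
  by right; apply: key.
case: ha => [->|[? [y [hy _ _]]]]; last by case: no; exists y.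
case: hb => [->|[? [y [hy _ _]]]]; last by case: no; exists y.
by left; vring.
Qed.

Lemma hull_subset s s' x : (forall v, v \in s -> v \in s') -> hull s x -> hull s' x.
Proof. by move=> h; apply: (@hull_sub _ (hull _)); [exact: hull_convex|move=> v /h; exact: mem_hull]. Qed.

Lemma hull_eq_mem s s' x : s =i s' -> hull s x <-> hull s' x.
Proof. by move=> e; split; apply: hull_subset => v; rewrite e. Qed.

Definition extreme (C : vec2 -> Prop) (v : vec2) := C v /\
  forall x y t, C x -> C y -> 0 < t < 1 -> v = (1 - t) *: x + t *: y -> x = y.

Lemma extreme_mem s v : extreme (hull s) v -> v \in s.
Proof.
elim: s v => [|w s IH] v [hv ext]; first by case: (hull_nil hv).
rewrite inE; case: eqVneq => //= nvw.
have [evw|[t [y [hy /andP[t0 t1] e]]]] := hull_cons hv; first by rewrite evw eqxx in nvw.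
have sub x : hull s x -> hull (w :: s) x.
  by apply: hull_subset => z; rewrite inE orbC => ->.
have hw : hull (w :: s) w by apply: mem_hull; rewrite mem_head.
have [t00|tn0] := eqVneq t 0.
  by case/eqP: nvw; rewrite e t00; vring.
have [t11|tn1] := eqVneq t 1.
  have evy : v = y by rewrite e t11; vring.
  apply: IH; split; first by rewrite evy.
  by move=> a b r ha hb; apply: ext; apply: sub.
have := ext _ _ t hw (sub _ hy) _ e.
rewrite !lt_def t0 t1 tn0 eq_sym tn1 => /(_ isT) ewy.
by case/eqP: nvw; rewrite e -ewy; vring.
Qed.

(** Split both ends of a segment through [v] by [hull_cons]. If the total weight [c] on [s] is
    positive, dividing by it puts [v] in [hull s]; if it is zero, both ends are [v]. *)
Lemma extreme_cons v s : ~ hull s v -> extreme (hull (v :: s)) v.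
Proof.
move=> nv; split; first by apply: mem_hull; rewrite mem_head.
move=> x y t hx hy /andP[t0 t1] e.
have [ex|[a [x' [hx' /andP[a0 a1] ex]]]] := hull_cons hx.
  have : t *: (v - y) = 0.
    by have -> : t *: (v - y) = v - ((1 - t) *: x + t *: y); [rewrite ex; vring|rewrite -e subrr].
  move/eqP; rewrite scaler_eq0 gt_eqF //= subr_eq0 => /eqP <-; exact: ex.
have [ey|[b [y' [hy' /andP[b0 b1] ey]]]] := hull_cons hy.
  have : (1 - t) *: (v - x) = 0.
    by have -> : (1 - t) *: (v - x) = v - ((1 - t) *: x + t *: y); [rewrite ey; vring|rewrite -e subrr].
  move/eqP; rewrite scaler_eq0 subr_eq0 gt_eqF //= subr_eq0 => /eqP <-; exact: esym.
pose c := (1 - t) * a + t * b.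
have c0 : 0 <= c by rewrite /c; nra.
have [ce|cn] := eqVneq c 0.
  have e1 : a = 0 by apply/eqP; rewrite eq_le; apply/andP; split; rewrite /c in ce; nra.
  have e2 : b = 0 by apply/eqP; rewrite eq_le; apply/andP; split; rewrite /c in ce; nra.
  by rewrite ex ey e1 e2; vring.
case: nv.
have -> : v = (1 - t * b / c) *: x' + (t * b / c) *: y'.
  have : c *: v = ((1 - t) * a) *: x' + (t * b) *: y'.
    have -> : c *: v = v - (1 - c) *: v by vring.
    by rewrite {1}e ex ey /c; vring.
  move/(congr1 (fun z => c^-1 *: z)); rewrite scalerA mulVf // scale1r => ->.
  by apply: vec2P; rewrite ?cE; move: cn; rewrite /c => cn; field.
apply: hull_convex => //; apply/andP; split.
  by apply: divr_ge0 => //; nra.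
by rewrite ler_pdivrMr ?lt_def ?cn // mul1r /c; nra.
Qed.

(** Generators lying in the hull of the others are deleted one by one; once none is left,
    [extreme_cons] applies to each. *)
Lemma hull_extreme s : exists s', (forall v, v \in s' -> extreme (hull s) v) /\
  forall x, hull s x <-> hull s' x.
Proof.
have [n le_n] := ubnP (size s); elim: n => // n IH in s le_n *.
have [[v [vs hv]]|no] := pselect (exists v, v \in s /\ hull (rem v s) v).
  have e x : hull s x <-> hull (rem v s) x.
    split; last by apply: hull_subset => w /mem_rem.
    apply: (@hull_sub _ (hull _)); first exact: hull_convex.
    move=> w; rewrite (perm_mem (perm_to_rem vs)) inE => /orP[/eqP->//|]; exact: mem_hull.
  have [|s' [h1 h2]] := IH (rem v s).
    by rewrite size_rem //; case: (s) vs le_n => //= *; lia.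
  exists s'; split; last by move=> x; rewrite e h2.
  move=> w /h1 [hw ext]; split; first by rewrite e.
  by move=> x y t; rewrite !e; apply: ext.
exists s; split => // v vs.
have nv : ~ hull (rem v s) v by move=> hv; case: no; exists v.
have [h1 h2] := extreme_cons nv.
have e x : hull s x <-> hull (v :: rem v s) x.
  by apply: hull_eq_mem => w; rewrite (perm_mem (perm_to_rem vs)).
by split=> [|x y t]; rewrite ?e //; apply: h2.
Qed.

(** * Loops of boundary points *)

Definition emb (p : pt) : vec2 := vec p.1%:~R p.2%:~R.
Definition idet (p q : pt) : int := p.1 * q.2 - p.2 * q.1.
Definition idot (p q : pt) : int := p.1 * q.1 + p.2 * q.2.
(** The step [q - p] turned clockwise by a right angle: an outer normal when the boundary is walked
    counterclockwise. Its value at both [p] and [q] is [idet p q]. *)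
Definition nrm (p q : pt) : pt := (q.2 - p.2, p.1 - q.1).
Definition mul (p : pt) (W : pt * pt) : pt :=
  (p.1 * W.1.1 + p.2 * W.2.1, p.1 * W.1.2 + p.2 * W.2.2).
Definition mulM (S W : pt * pt) : pt * pt := (mul S.1 W, mul S.2 W).
Definition mdet (W : pt * pt) : int := idet W.1 W.2.
Definition ap (W : pt * pt) (x : vec2) : vec2 :=
  vec (cx x * W.1.1%:~R + cy x * W.2.1%:~R) (cx x * W.1.2%:~R + cy x * W.2.2%:~R).
Definition apV (W : pt * pt) (x : vec2) : vec2 :=
  vec ((cx x * W.2.2%:~R - cy x * W.2.1%:~R) / (mdet W)%:~R)
      ((cy x * W.1.1%:~R - cx x * W.1.2%:~R) / (mdet W)%:~R).

Lemma cx_emb p : cx (emb p) = p.1%:~R. Proof. exact: cx_vec. Qed.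
Lemma cy_emb p : cy (emb p) = p.2%:~R. Proof. exact: cy_vec. Qed.
Definition ceE := (cx_emb, cy_emb, cE).

Lemma emb_inj : injective emb.
Proof.
move=> [a b] [c d] e; move: (congr1 cx e) (congr1 cy e); rewrite !ceE /=.
by move=> /intr_inj -> /intr_inj ->.
Qed.

Lemma det_emb p q : det (emb p) (emb q) = (idet p q)%:~R.
Proof. by rewrite /det !ceE /idet; ring. Qed.

Lemma dot_emb p q : dot (emb p) (emb q) = (idot p q)%:~R.
Proof. by rewrite /dot !ceE /idot; ring. Qed.

Lemma emb_mul p W : emb (mul p W) = ap W (emb p).
Proof. by apply: vec2P; rewrite !ceE /=; ring. Qed.

Lemma apK W : mdet W != 0 -> cancel (ap W) (apV W).
Proof.
rewrite -(intr_eq0 rat) /mdet /idet => h x; rewrite /apV /mdet /idet; apply: vec2P; rewrite !ceE;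
 move: h; rewrite !(rmorphB, rmorphM) /= => h; field.
all: by rewrite h.
Qed.

Lemma apVK W : mdet W != 0 -> cancel (apV W) (ap W).
Proof.
rewrite -(intr_eq0 rat) /mdet /idet => h x; rewrite /apV /mdet /idet; apply: vec2P; rewrite !ceE;
 move: h; rewrite !(rmorphB, rmorphM) /= => h; field.
all: by rewrite h.
Qed.

Lemma ap_comb W x y a b : ap W (a *: x + b *: y) = a *: ap W x + b *: ap W y.
Proof. by vring. Qed.

Lemma ap_mulM S W x : ap (mulM S W) x = ap W (ap S x).
Proof. by apply: vec2P; rewrite ?ceE /=; ring. Qed.

Lemma mul_mulM p S W : mul p (mulM S W) = mul (mul p S) W.
Proof. by rewrite /mul /mulM /=; congr pair; rewrite /mul /=; ring. Qed.

Lemma mulM_A S T W : mulM S (mulM T W) = mulM (mulM S T) W.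
Proof. by rewrite {1 3}/mulM !mul_mulM. Qed.

Lemma mdetM S W : mdet (mulM S W) = mdet S * mdet W.
Proof. by rewrite /mdet /mulM /mul /idet /=; ring. Qed.

Lemma det_ap W x y : det (ap W x) (ap W y) = det x y * (mdet W)%:~R.
Proof. by rewrite /det ?ceE /mdet /idet; ring. Qed.

Lemma dot_comb u a b x y : dot u (a *: x + b *: y) = a * dot u x + b * dot u y.
Proof. by rewrite /dot ?cE; ring. Qed.

Definition edge (Q : seq pt) (x : pt) : pt := nrm x (next Q x).

(* By the last condition the opposite of [(1, 0) + (0, 1)] lies in the cone over
   an edge, so the origin is interior to the convex hull. *)
Definition goodloop (Q : seq pt) : bool :=
  [&& uniq Q, (1, 0) \in Q, (0, 1) \in Q,
      all (fun x => idet x (next Q x) == 1) Q,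
      all (fun x => all (fun y => idot (edge Q x) y <= 1) Q) Q
    & has (fun x => (0 <= idet x (-1, -1)) && (0 <= idet (-1, -1) (next Q x))) Q].

Definition polyhull (Q : seq pt) : vec2 -> Prop := hull (map emb Q).

Lemma mem_polyhull Q q : q \in Q -> polyhull Q (emb q).
Proof. by move=> qQ; apply: mem_hull; rewrite map_f. Qed.

Lemma polyhull_sub Q (C : vec2 -> Prop) x : convex_pred C ->
  (forall q, q \in Q -> C (emb q)) -> polyhull Q x -> C x.
Proof. by move=> cC h; apply: hull_sub => // v /mapP[q qQ ->]; apply: h. Qed.

Section GoodLoop.
Variable Q : seq pt.
Hypothesis gQ : goodloop Q.

Let n (x : pt) := emb (edge Q x).

Lemma good_uniq : uniq Q. Proof. by case/and5P: gQ. Qed.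
Lemma good10 : (1, 0) \in Q. Proof. by case/and5P: gQ. Qed.
Lemma good01 : (0, 1) \in Q. Proof. by case/and5P: gQ. Qed.
Lemma good_det x : x \in Q -> idet x (next Q x) = 1.
Proof. by case/and5P: gQ => _ _ _ /allP h _ xQ; apply/eqP/h. Qed.
Lemma good_edge x y : x \in Q -> y \in Q -> idot (edge Q x) y <= 1.
Proof. by case/and5P: gQ => _ _ _ _ /andP[/allP h _] xQ yQ; have /allP := h _ xQ; apply. Qed.

Lemma edge_l x : x \in Q -> dot (n x) (emb x) = 1.
Proof.
move=> xQ; rewrite dot_emb; have -> : idot (edge Q x) x = idet x (next Q x).
  by rewrite /edge /idot /nrm /idet /=; ring.
by rewrite good_det.
Qed.

Lemma edge_r x : x \in Q -> dot (n x) (emb (next Q x)) = 1.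
Proof.
move=> xQ; rewrite dot_emb; have -> : idot (edge Q x) (next Q x) = idet x (next Q x).
  by rewrite /edge /idot /nrm /idet /=; ring.
by rewrite good_det.
Qed.

Lemma edge_le x y : x \in Q -> polyhull Q y -> dot (n x) y <= 1.
Proof.
move=> xQ; apply: (@polyhull_sub _ (fun y => dot (n x) y <= 1)).
  exact: convex_le.
by move=> q qQ; rewrite dot_emb lerz1 good_edge.
Qed.

(** A relation with nonnegative coefficients in which the two basis vectors have coefficient 1: it
    witnesses that the loop surrounds the origin. *)
Lemma opposite_cone : exists (x y : pt) (a b : rat), [/\ x \in Q /\ y \in Q, 0 <= a, 0 <= b
  & emb (1, 0) + emb (0, 1) + (a *: emb x + b *: emb y) = 0].
Proof.
case/and5P: (gQ) => _ _ _ _ /andP[_] /hasP[x xQ /andP[h1 h2]].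
have nQ : next Q x \in Q by rewrite mem_next.
exists x, (next Q x), (idet (-1, -1) (next Q x))%:~R, (idet x (-1, -1))%:~R.
split; rewrite ?ler0z //.
have d : det (emb x) (emb (next Q x)) = 1 by rewrite det_emb good_det.
have := @cramer (emb x) (emb (next Q x)) (emb (-1, -1)).
rewrite d oner_eq0 !divr1 !det_emb => /(_ isT) <-.
by apply: vec2P; rewrite !ceE.
Qed.

(** Otherwise all terms of the relation in [opposite_cone], paired with [p], are nonnegative and
    hence zero, so that [p] is parallel to both basis vectors. *)
Lemma det_neg p : p != 0 -> exists2 x, x \in Q & det (emb x) p < 0.
Proof.
move=> np; have [//|no] := pselect (exists2 x, x \in Q & det (emb x) p < 0).
have ge x : x \in Q -> 0 <= det (emb x) p.
  by move=> xQ; rewrite leNgt; apply/negP => h; apply: no; exists x.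
have [x [y [a [b [[xQ yQ] a0 b0 e]]]]] := opposite_cone.
have h1 := ge _ good10; have h2 := ge _ good01; have hx := ge _ xQ; have hy := ge _ yQ.
have : det (emb (1, 0)) p + det (emb (0, 1)) p + (a * det (emb x) p + b * det (emb y) p) = 0.
  have -> : det (emb (1, 0)) p + det (emb (0, 1)) p + (a * det (emb x) p + b * det (emb y) p) =
     det (emb (1, 0) + emb (0, 1) + (a *: emb x + b *: emb y)) p by rewrite /det !cE; ring.
  by rewrite e /det !cE; ring.
have ha := mulr_ge0 a0 hx; have hb := mulr_ge0 b0 hy => s0.
have e1 : det (emb (1, 0)) p = 0 by lra.
have e2 : det (emb (0, 1)) p = 0 by lra.
case/eqP: np; apply: vec2P; rewrite cE; [move: e2|move: e1]; rewrite /det !ceE /=; lra.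
Qed.

Lemma det_pos p : p != 0 -> exists2 x, x \in Q & 0 < det (emb x) p.
Proof.
move=> np; have [|x xQ h] := @det_neg (- p); first by rewrite oppr_eq0.
exists x => //; move: h; rewrite /det !ceE; lra.
Qed.

(* The sign of [det x p] changes along the loop, at an edge whose cone
   contains [p]. *)
Lemma cover p : p != 0 -> exists x, [/\ x \in Q, 0 < det p (emb (next Q x)),
  0 <= det (emb x) p,
  p = det p (emb (next Q x)) *: emb x + det (emb x) p *: emb (next Q x)
  & dot (n x) p = det p (emb (next Q x)) + det (emb x) p].
Proof.
move=> np; pose P x := 0 <= det (emb x) p.
have [y yQ hy] := det_neg np; have [z zQ hz] := det_pos np.
(* If [P] were never lost along the loop, transitivity around the cycle would carry it from [z] to
   [y]. *)
have : ~~ cycle (fun a b => P a ==> P b) Q.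
  rewrite cycle_all2rel; last by move=> b a c; case: (P a); case: (P b).
  apply/negP => /allrelP /(_ _ _ zQ yQ); rewrite /P (ltW hz) /= leNgt hy //.
move/negP => nc; have [[x [xQ Px nPx]]|no] := pselect (exists x, [/\ x \in Q, P x & ~~ P (next Q x)]).
  have d : det (emb x) (emb (next Q x)) = 1 by rewrite det_emb good_det.
  have ep : p = det p (emb (next Q x)) *: emb x + det (emb x) p *: emb (next Q x).
    by rewrite {1}(@cramer (emb x) (emb (next Q x)) p) d ?oner_eq0 // !divr1.
  exists x; split => //.
  - by move: nPx; rewrite /P -ltNge /det; lra.
  - by rewrite {1}ep dot_comb edge_l // edge_r // !mulr1.
case: nc; apply: cycle_from_next; first exact: good_uniq.
move=> x xQ; apply/implyP => Px; apply/negPn/negP => nPx; apply: no.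
by exists x.
Qed.

Lemma polyhull0 : polyhull Q 0.
Proof.
have [x [y [a [b [[xQ yQ] a0 b0 e]]]]] := opposite_cone.
have s0 : 0 < a + b.
  rewrite lt_def addr_ge0 // andbT; apply/eqP => ab; have ea : a = 0 by lra.
  have eb : b = 0 by lra.
  by have := congr1 cx e; rewrite ea eb !ceE /=; lra.
have n0 : a + b != 0 by rewrite gt_eqF.
have n2 : 2%:R + a + b != 0 by rewrite gt_eqF //; lra.
pose m := (1 - 1 / 2%:R) *: emb (1, 0) + (1 / 2%:R) *: emb (0, 1).
pose z := (1 - b / (a + b)) *: emb x + (b / (a + b)) *: emb y.
have hm : polyhull Q m.
  by apply: hull_convex; [exact: mem_polyhull good10|exact: mem_polyhull good01|].
have hz : polyhull Q z.
  apply: hull_convex; [exact: mem_polyhull|exact: mem_polyhull|].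
  by rewrite divr_ge0 ?(ltW s0) //= ler_pdivrMr // mul1r; lra.
have -> : 0 = (1 - (a + b) / (2%:R + a + b)) *: m + ((a + b) / (2%:R + a + b)) *: z.
  have -> : (1 - (a + b) / (2%:R + a + b)) *: m + ((a + b) / (2%:R + a + b)) *: z =
     (2%:R + a + b)^-1 *: (emb (1, 0) + emb (0, 1) + (a *: emb x + b *: emb y)).
    by apply: vec2P; rewrite /m /z !cE; field; rewrite n0 n2.
  by rewrite e scaler0.
apply: hull_convex => //; rewrite divr_ge0 ?(ltW s0) //=; last by lra.
by rewrite ler_pdivrMr ?mul1r; lra.
Qed.

Lemma convex3 (C : vec2 -> Prop) x y a b : convex_pred C -> C 0 -> C x -> C y ->
  0 <= a -> 0 <= b -> a + b <= 1 -> C (a *: x + b *: y).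
Proof.
move=> cC c0 hx hy a0 b0 ab; have [e|ne] := eqVneq (a + b) 0.
  have -> : a = 0 by lra.
  have -> : b = 0 by lra.
  by rewrite !scale0r addr0.
have lt : 0 < a + b by rewrite lt_def ne addr_ge0.
have -> : a *: x + b *: y =
  (1 - (a + b)) *: 0 + (a + b) *: ((1 - b / (a + b)) *: x + (b / (a + b)) *: y).
  by apply: vec2P; rewrite ?cE; field.
apply: (cC) => //; last by rewrite ab ltW.
apply: cC => //; rewrite divr_ge0 ?(ltW lt) //= ler_pdivrMr // mul1r; lra.
Qed.

(** For the converse, [y] lies in the cone over some edge, and the inequality of that edge bounds
    the sum of its two coordinates there by 1. *)
Lemma polyhullP y : polyhull Q y <-> forall x, x \in Q -> dot (n x) y <= 1.
Proof.
split=> [hy x xQ|h]; first exact: edge_le.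
have [->|ny] := eqVneq y 0; first exact: polyhull0.
have [x [xQ a b ey e]] := cover ny; rewrite ey.
apply: convex3 => //; [exact: hull_convex|exact: polyhull0|exact: mem_polyhull| |exact: ltW|].
  by apply: mem_polyhull; rewrite mem_next.
by rewrite -e; apply: h.
Qed.

(** The ends of an edge form a lattice basis, so in its cone [z] has integer coordinates [u > 0] and
    [v >= 0]; then [u + v <= 1] leaves only the first end. *)
Lemma polyhull_int z : z != 0 -> polyhull Q (emb z) -> z \in Q.
Proof.
move=> nz hz; have nz' : emb z != 0.
  by apply: contra nz => /eqP e; apply/eqP/emb_inj; rewrite e; apply: vec2P; rewrite !ceE.
have [x [xQ]] := cover nz'; rewrite !det_emb => a b ez e.
have := edge_le xQ hz; rewrite e; move: a b ez; move: (idet z _) (idet x _) => u v.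
rewrite ltr0z ler0z -intrD lerz1 => a b ez ab.
have u1 : u = 1 by lia.
have v0 : v = 0 by lia.
suff -> : z = x by [].
by apply: emb_inj; rewrite ez u1 v0; vring.
Qed.

End GoodLoop.

Lemma conv_rows_hull k (A : 'M[rat]_(k, 2)) x :
  conv_rows A x <-> hull [seq row i A | i <- enum 'I_k] x.
Proof.
have rowE w : w *m A = \sum_i w 0 i *: row i A :> vec2 by rewrite mulmx_sum_row.
split.
  case=> w [w0 w1] <- C cC hC; rewrite rowE.
  (* Partial sums are normalised so as to stay in [C]; total weight zero is kept apart because
     nothing can be normalised then. *)
  have key s : let T := \sum_(i <- s) w 0 i in
      (T = 0 /\ \sum_(i <- s) w 0 i *: row i A = 0) \/
      (0 < T /\ C (T^-1 *: \sum_(i <- s) w 0 i *: row i A)).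
    elim: s => [|i s IH] /=; first by left; rewrite !big_nil.
    rewrite !big_cons; have hi : C (row i A) by apply: hC; apply/mapP; exists i; rewrite ?mem_enum.
    case: IH => [[-> ->]|[]].
      have [->|ne] := eqVneq (w 0 i) 0; first by left; rewrite scale0r !addr0.
      by right; rewrite !addr0 scalerA mulVf // scale1r lt_def ne w0.
    set T := \sum_(j <- s) _; set V := \sum_(j <- s) _; move: (w0 i).
    move: T V (w 0 i) => T V a a0 T0 CV; right; have T1 : 0 < a + T by lra.
    split => //.
    have -> : (a + T)^-1 *: (a *: row i A + V) =
       (1 - T / (a + T)) *: row i A + (T / (a + T)) *: (T^-1 *: V).
      by apply: vec2P; rewrite ?cE; field; rewrite !gt_eqF.
    apply: (cC) => //; rewrite divr_ge0 ?(ltW T0) ?(ltW T1) //=.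
    by rewrite ler_pdivrMr // mul1r; lra.
  have := key (index_enum 'I_k); rewrite /= w1 => -[[/eqP]|[_]]; first by rewrite oner_eq0.
  by rewrite invr1 scale1r.
apply: (@hull_sub _ (conv_rows A)).
  move=> a b t [u [u0 u1] <-] [v [v0 v1] <-] /andP[t0 t1].
  exists ((1 - t) *: u + t *: v); last by rewrite mulmxDl -!scalemxAl.
  split=> [i|]; first by rewrite !mxE; have := u0 i; have := v0 i; nra.
  under eq_bigr do rewrite !mxE.
  by rewrite big_split -!mulr_sumr u1 v1 /=; ring.
move=> _ /mapP[i _ ->]; exists (delta_mx 0 i); last by rewrite -matrix.rowE.
split=> [j|]; first by rewrite mxE ler0n.
rewrite (bigD1 i) //= big1 ?addr0 ?mxE ?eqxx // => j ne.
by rewrite mxE (negbTE ne) andbF.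
Qed.

(** * Primitive lattice points and coprime coordinates *)

Definition zvec (p : pt) : 'rV[int]_2 := \row_i (if i == 0 then p.1 else p.2).
Definition cop (p : pt) : bool := coprimez p.1 p.2.

Lemma lat_zvec p : lat (zvec p) = emb p.
Proof. by apply: vec2P; rewrite !ceE /cx /cy !mxE. Qed.

Lemma latE (z : 'rV[int]_2) : lat z = emb (z 0 0, z 0 1).
Proof. by apply: vec2P; rewrite !ceE /cx /cy !mxE. Qed.

Lemma zvecE (z : 'rV[int]_2) : z = zvec (z 0 0, z 0 1).
Proof.
apply/rowP=> i; rewrite mxE; case: i => [[|[|//]] hi] /=; congr (z _ _); exact/val_inj.
Qed.

Lemma zvec0 : zvec (0, 0) = 0.
Proof. by apply/rowP => i; rewrite !mxE; case: ifP. Qed.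

Lemma zvec_inj : injective zvec.
Proof.
by move=> [a b] [c d] /rowP e; have := e 0; have := e 1; rewrite !mxE /= => -> ->.
Qed.

Lemma copP p : reflect (exists u v, u * p.1 + v * p.2 = 1) (cop p).
Proof. by apply: (iffP (coprimezP _ _)) => [[[u v] /= h]|[u [v h]]]; [exists u, v|exists (u, v)]. Qed.

Lemma primitiveE p : primitive (zvec p) <-> cop p.
Proof.
split.
- case=> nz h; rewrite /cop /coprimez; set g := gcdz _ _.
  have g0 : g != 0.
    rewrite gcdz_eq0; apply/negP => /andP[/eqP e1 /eqP e2]; apply: nz.
    by apply/rowP => i; rewrite !mxE e1 e2; case: ifP.
  have /dvdzP[a ea] : (g %| p.1)%Z by rewrite dvdz_gcdl.
  have /dvdzP[b eb] : (g %| p.2)%Z by rewrite dvdz_gcdr.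
  have gp : 0 < g by rewrite lt_def g0.
  have : segment 0 (lat (zvec p)) (lat (zvec (a, b))).
    exists (g%:~R^-1) => /=; first by rewrite invr_ge0 ler0z ltW //= invf_le1 ?ler1z ?ltr0z //; lia.
    have gr : g%:~R != 0 :> rat by rewrite intr_eq0.
    rewrite !lat_zvec; apply: vec2P; rewrite !ceE ?ea ?eb ?rmorphM /=; field; exact: gr.
  case/h => [/rowP e|/zvec_inj e].
    have := e 0; have := e 1; rewrite !mxE /= => e1 e2.
    by case: nz; apply/rowP => i; rewrite !mxE ea eb e1 e2 !mul0r; case: ifP.
  have e1 : a = p.1 by rewrite -e.
  have e2 : b = p.2 by rewrite -e.
  rewrite e1 in ea; rewrite e2 in eb.
  move: (g0); rewrite {1}/g gcdz_eq0 negb_and => /orP[] ne; apply/eqP/(mulfI ne).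
    by rewrite mulr1 -ea.
  by rewrite mulr1 -eb.
- move/copP => [u [v e]]; split.
    by move/rowP => e0; have := e0 0; have := e0 1; rewrite !mxE /= => e1 e2; move: e; rewrite e1 e2; lia.
  move=> y [t /= /andP[t0 t1]]; rewrite lat_zvec latE => ey.
  have h1 : t * p.1%:~R = (y 0 0)%:~R by have := congr1 cx ey; rewrite !ceE /=; lra.
  have h2 : t * p.2%:~R = (y 0 1)%:~R by have := congr1 cy ey; rewrite !ceE /=; lra.
  (* By the Bezout relation the scaling factor is an integer combination of integer coordinates, so
     it is 0 or 1. *)
  have ht : t = (u * y 0 0 + v * y 0 1)%:~R.
    have er : u%:~R * p.1%:~R + v%:~R * p.2%:~R = 1 :> rat.
      by rewrite -!rmorphM -rmorphD /= e.
    by rewrite rmorphD !rmorphM /= -h1 -h2; transitivity (t * (u%:~R * p.1%:~R + v%:~R * p.2%:~R)); [rewrite er mulr1|ring].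
  move: t0 t1; rewrite ht ler0z lerz1 => t0 t1.
  have [t2|t2] : u * y 0 0 + v * y 0 1 = 0 \/ u * y 0 0 + v * y 0 1 = 1 by lia.
  + left; move: h1 h2; rewrite ht t2 !mul0r => /esym/eqP; rewrite intr_eq0 => /eqP y1 /esym/eqP.
    rewrite intr_eq0 => /eqP y2.
    by rewrite (zvecE y) y1 y2 zvec0.
  + right; move: h1 h2; rewrite ht t2 !mul1r => /intr_inj y1 /intr_inj y2.
    by rewrite (zvecE y) -y1 -y2; case: (p).
Qed.

Lemma dotC u v : dot u v = dot v u. Proof. by rewrite /dot; ring. Qed.

Lemma dotZ u a x : dot u (a *: x) = a * dot u x.
Proof. by rewrite /dot !cE; ring. Qed.

Lemma scale_gt1 (T : eqType) (s : seq T) (f : T -> rat) :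
  (forall x, x \in s -> f x < 1) ->
  exists2 t : rat, 1 < t & forall x, x \in s -> t * f x <= 1.
Proof.
elim: s => [|a s IH] h; first by exists 2%:R.
have [|t t1 ht] := IH; first by move=> x xs; apply: h; rewrite inE xs orbT.
have fa : f a < 1 by apply: h; rewrite mem_head.
have le_t r x : r <= t -> 0 < r -> x \in s -> r * f x <= 1.
  by move=> rt r0 xs; have := ht x xs; nra.
have [f0|f0] := lerP (f a) 0.
  exists t => // x; rewrite inE => /orP[/eqP->|]; last exact: ht.
  by nra.
exists (Num.min t (f a)^-1); first by rewrite lt_min t1 invf_gt1.
have m0 : 0 < Num.min t (f a)^-1 by rewrite lt_min invr_gt0 f0 (lt_trans _ t1).
move=> x; rewrite inE => /orP[/eqP->|xs].
  by rewrite -ler_pdivlMr // mul1r ge_min lexx orbT.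
by apply: le_t => //; rewrite ge_min lexx.
Qed.

Lemma seq_ubound (T : eqType) (s : seq T) (f : T -> rat) :
  exists2 m : rat, 0 < m & forall x, x \in s -> f x <= m.
Proof.
elim: s => [|a s [m m0 h]]; first by exists 1.
exists (m + `|f a|) => [|x]; first by rewrite ltr_wpDr.
rewrite inE => /orP[/eqP->|/h]; first by have := ler_norm (f a); lra.
by have := normr_ge0 (f a); lra.
Qed.

(** * Edges and vertices of the polygon of a loop *)

Section Facets.
Variable Q : seq pt.
Hypothesis gQ : goodloop Q.
Let n (x : pt) := emb (edge Q x).

Lemma emb_next_neq x : x \in Q -> emb x != emb (next Q x).
Proof.
move=> xQ; apply/eqP => e; have := good_det gQ xQ.
by move/(congr1 (fun z : int => z%:~R : rat)); rewrite -det_emb e /det [X in X - _]mulrC subrr => /esym/eqP; rewrite oner_eq0.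
Qed.

(** An edge inequality that is tight at the midpoint is tight at both ends. If none is tight there,
    the midpoint can be pushed outwards inside the hull, beyond the supporting line. *)
Lemma facet_edge u c y0 y1 : 0 < c -> (forall y, polyhull Q y -> dot u y <= c) ->
  polyhull Q y0 -> polyhull Q y1 -> y0 != y1 -> dot u y0 = c -> dot u y1 = c ->
  exists x, [/\ x \in Q, dot (n x) y0 = 1, dot (n x) y1 = 1 & u = c *: n x].
Proof.
move=> c0 hu h0 h1 ne e0 e1.
pose m := (1 - 1 / 2%:R) *: y0 + (1 / 2%:R) *: y1.
have hm : polyhull Q m by apply: hull_convex => //; apply/andP; split; lra.
have em : dot u m = c by rewrite dot_comb e0 e1; field.
have [[x [xQ ex]]|no] := pselect (exists x, x \in Q /\ dot (n x) m = 1).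
  have l0 := edge_le gQ xQ h0; have l1 := edge_le gQ xQ h1.
  move: ex; rewrite dot_comb => ex.
  have f0 : dot (n x) y0 = 1 by move: l0 l1 ex; rewrite -/(n x); lra.
  have f1 : dot (n x) y1 = 1 by move: l0 l1 ex; rewrite -/(n x); lra.
  exists x; split => //.
  have d : det y0 y1 != 0 by apply: (@dot_det0 u); rewrite ?e0 ?e1 // gt_eqF.
  apply: (dot_inj d); rewrite dotC [RHS]dotC dotZ dotC.
    by rewrite e0 dotC f0 mulr1.
  by rewrite e1 dotC f1 mulr1.
have [|t t1 ht] := @scale_gt1 _ Q (fun x => dot (n x) m).
  by move=> x xQ; rewrite lt_neqAle (edge_le gQ xQ hm) andbT; apply/eqP => e; apply: no; exists x.
have : polyhull Q (t *: m) by apply/polyhullP => // x xQ; rewrite dotZ ht.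
by move/hu; rewrite dotZ em; nra.
Qed.

Definition vtx x := edge Q (prev Q x) != edge Q x.

Lemma vtx_extreme x : x \in Q -> vtx x -> extreme (polyhull Q) (emb x).
Proof.
move=> xQ vx; split; first exact: mem_polyhull.
move=> a b t ha hb /andP[t0 t1] e; apply/eqP/negPn/negP => nab; case/negP: vx; apply/eqP.
have pQ : prev Q x \in Q by rewrite mem_prev.
have e1 := edge_l gQ xQ; have e2 := edge_r gQ pQ; rewrite (next_prev (good_uniq gQ)) in e2.
have a1 := edge_le gQ xQ ha; have b1 := edge_le gQ xQ hb.
have a2 := edge_le gQ pQ ha; have b2 := edge_le gQ pQ hb.
move: e1 e2; rewrite e !dot_comb => e1 e2.
have ea1 : dot (n x) a = 1 by move: e1 a1 b1; rewrite -/(n x); nra.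
have eb1 : dot (n x) b = 1 by move: e1 a1 b1; rewrite -/(n x); nra.
have ea2 : dot (n (prev Q x)) a = 1 by move: e2 a2 b2; rewrite -/(n _); nra.
have eb2 : dot (n (prev Q x)) b = 1 by move: e2 a2 b2; rewrite -/(n _); nra.
have d : det a b != 0 by apply: (@dot_det0 (n x)); rewrite ?ea1 ?eb1 // oner_eq0.
exact: (emb_inj (dot_inj d (etrans ea2 (esym ea1)) (etrans eb2 (esym eb1)))).
Qed.

(** Where the normal does not change, the point is the midpoint of its neighbours; extremality would
    identify these, against the two determinants 1. *)
Lemma extreme_polyhull v : extreme (polyhull Q) v -> exists x, [/\ x \in Q, vtx x & v = emb x].
Proof.
move=> ev; have /mapP[x xQ e] := extreme_mem ev; exists x; split => //.
apply/negP => /eqP ee; have pQ : prev Q x \in Q by rewrite mem_prev.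
case: ev => _ /(_ (emb (prev Q x)) (emb (next Q x)) (1 / 2%:R)) h.
have : emb (prev Q x) = emb (next Q x).
  apply: h; [exact: mem_polyhull|by apply: mem_polyhull; rewrite mem_next|by []|].
  move: ee; rewrite /edge (next_prev (good_uniq gQ)) /nrm => -[e1 e2].
  have mid (a b c : int) : b - a = a - c -> c = 2 * a - b by lia.
  have mid' (a b c : int) : a - b = c - a -> c = 2 * a - b by lia.
  rewrite e; apply: vec2P; rewrite !ceE.
    rewrite (mid _ _ _ e2).
    by rewrite rmorphB rmorphM /=; field.
  rewrite (mid' _ _ _ e1).
  by rewrite rmorphB rmorphM /=; field.
move/emb_inj => e1; have := good_det gQ xQ; have := good_det gQ pQ.
by rewrite (next_prev (good_uniq gQ)) e1 /idet; lia.
Qed.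

End Facets.

Definition polygon (Q : seq pt) (W : pt * pt) : set vec2 := [set ap W y | y in polyhull Q]%classic.

(* The edge normal of the image under [W]: it takes the value [|det W|] times
   that of [n] (see [dot_onrm]). *)
Definition onrm (W : pt * pt) (n : pt) : pt :=
  (sgz (mdet W) * (n.1 * W.2.2 - n.2 * W.1.2), sgz (mdet W) * (n.2 * W.1.1 - n.1 * W.2.1)).

Lemma dot_onrm W n y : dot (emb (onrm W n)) (ap W y) = (`|mdet W|%N : int)%:~R * dot (emb n) y.
Proof.
rewrite abszEsg /dot !ceE /= !rmorphM /= /mdet /idet !(rmorphB, rmorphM) /=; ring.
Qed.

Definition valid (Q : seq pt) (W : pt * pt) : bool :=
  all (fun x => (vtx Q x ==> cop (mul x W)) && cop (onrm W (edge Q x))) Q.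

(** * Images of loops under integer matrices *)

Local Open Scope classical_set_scope.

Lemma extreme_ap W b (C : set vec2) v : mdet W != 0 ->
  extreme [set ap W y + b | y in C] (ap W v + b) <-> extreme C v.
Proof.
move=> W0; have inj : injective (fun y => ap W y + b).
  by move=> y z /addIr /(can_inj (apK W0)).
split=> [[[y Cy /inj e]] h|[Cv h]].
  split=> [|x z t Cx Cz ht ev]; first by rewrite -e.
  apply: inj; apply: h ht _; [by exists x|by exists z|].
  by rewrite ev ap_comb; vring.
split=> [|_ _ t [x Cx <-] [z Cz <-] ht ev]; first by exists v.
congr (ap W _ + b); apply: h Cx Cz ht _; apply: inj; rewrite /= ev ap_comb; vring.
Qed.

Lemma polygonE Q W : polygon Q W = [set ap W y + 0 | y in polyhull Q].
Proof. by apply/funext => z; apply/propext; split=> -[y hy <-]; exists y; rewrite ?addr0. Qed.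

Section Polygon.
Variables (Q : seq pt) (W : pt * pt) (l : nat).
Hypotheses (gQ : goodloop Q) (l0 : (0 < l)%N) (dW : `|mdet W|%N = l).

Let on x := emb (onrm W (edge Q x)).

Let W0 : mdet W != 0. Proof. by rewrite -absz_gt0 dW. Qed.
Let lr0 : 0 < l%:R :> rat. Proof. by rewrite ltr0n. Qed.

Lemma dot_on x y : dot (on x) (ap W y) = l%:R * dot (emb (edge Q x)) y.
Proof. by rewrite dot_onrm dW. Qed.

Lemma polygon_le x z : x \in Q -> polygon Q W z -> dot (on x) z <= l%:R.
Proof.
move=> xQ [y hy <-]; rewrite dot_on; have := edge_le gQ xQ hy.
by rewrite -[X in _ -> _ <= X]mulr1 ler_pM2l.
Qed.

Lemma polygonP z : polygon Q W z <-> forall x, x \in Q -> dot (on x) z <= l%:R.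
Proof.
split=> [hz x xQ|h]; first exact: polygon_le.
exists (apV W z); last by rewrite apVK.
apply/polyhullP => // x /h; rewrite -{1}(apVK W0 z) dot_on.
by rewrite -[X in _ <= X -> _]mulr1 ler_pM2l.
Qed.

Lemma polygon_mem x : x \in Q -> polygon Q W (ap W (emb x)).
Proof. by move=> xQ; exists (emb x) => //; apply: mem_polyhull. Qed.

Lemma on_l x : x \in Q -> dot (on x) (ap W (emb x)) = l%:R.
Proof. by move=> xQ; rewrite dot_on edge_l // mulr1. Qed.

Lemma on_r x : x \in Q -> dot (on x) (ap W (emb (next Q x))) = l%:R.
Proof. by move=> xQ; rewrite dot_on edge_r // mulr1. Qed.

Lemma polygon_vertices v : vertices (polygon Q W) v <->
  exists x, [/\ x \in Q, vtx Q x & v = ap W (emb x)].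
Proof.
rewrite polygonE; split=> [hv|[x [xQ vx ->]]].
  have [y hy ey] : polygon Q W v by rewrite polygonE; case: hv.
  have : extreme (polyhull Q) y.
    by apply/(@extreme_ap W 0) => //; rewrite ey addr0.
  by case/(extreme_polyhull gQ) => x [xQ vx e]; exists x; split; rewrite // -e.
rewrite -[ap _ _]addr0; apply/extreme_ap => //; exact: vtx_extreme.
Qed.

Lemma polygon_facet_edge u c z0 z1 : 0 < c -> (forall z, polygon Q W z -> dot u z <= c) ->
  polygon Q W z0 -> polygon Q W z1 -> z0 != z1 -> dot u z0 = c -> dot u z1 = c ->
  exists x, [/\ x \in Q, dot (on x) z0 = l%:R, dot (on x) z1 = l%:R & l%:R *: u = c *: on x].
Proof.
move=> c0 hu [y0 h0 <-] [y1 h1 <-] ne e0 e1.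
(* [u'] is the functional [u] pulled back along [W]. *)
pose u' := vec (cx u * W.1.1%:~R + cy u * W.1.2%:~R) (cx u * W.2.1%:~R + cy u * W.2.2%:~R).
have du y : dot u (ap W y) = dot u' y by rewrite /dot !cE; ring.
have [||||x [xQ a0 a1 eu]] := @facet_edge _ gQ u' c y0 y1 c0 _ h0 h1; rewrite -?du //.
- by move=> y hy; rewrite -du; apply: hu; exists y.
- by apply: contra ne => /eqP->.
exists x; split; rewrite ?dot_on ?a0 ?a1 ?mulr1 //.
have ne' : y0 != y1 by apply: contra ne => /eqP->.
have dt : det y0 y1 != 0.
  by apply: (@dot_det0 (emb (edge Q x))); rewrite ?a0 ?a1 ?oner_eq0.
have d : det (ap W y0) (ap W y1) != 0 by rewrite det_ap mulf_neq0 ?intr_eq0.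
have dZ a (v w : vec2) : dot (a *: v) w = a * dot v w by rewrite /dot !cE; ring.
by apply: (dot_inj d); rewrite !dZ dot_on ?a0 ?a1 ?e0 ?e1; ring.
Qed.

Lemma polygon_dot_pos u : u != 0 -> exists2 x, x \in Q & 0 < dot u (ap W (emb x)).
Proof.
(* [p] is chosen so that [det y p] is the value of [u] at the image of [y], which reduces the claim
   to [det_pos]. *)
move=> nu; pose p := vec (- (cx u * W.2.1%:~R + cy u * W.2.2%:~R)) (cx u * W.1.1%:~R + cy u * W.1.2%:~R).
have du y : dot u (ap W y) = det y p by rewrite /dot /det !cE; ring.
have [|x xQ h] := @det_pos _ gQ p; last by exists x; rewrite ?du.
apply: contra nu => /eqP ep; have d y : dot u y = 0.
  by rewrite -(apVK W0 y) du ep /det !cE; ring.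
apply/eqP/vec2P; rewrite cE; [have := d (vec 1 0)|have := d (vec 0 1)]; rewrite /dot !cE; lra.
Qed.

End Polygon.

Lemma row_free_mx2 (A : 'M[rat]_2) : det (row 0 A) (row 1 A) != 0 -> row_free A.
Proof.
move=> d; apply/row_freeP; exists (\matrix_(i, j)
  ((if i == 0 then (if j == 0 then A 1 1 else - A 0 1) else (if j == 0 then - A 1 0 else A 0 0))
  / det (row 0 A) (row 1 A))).
have e (i : 'I_2) : i = 0 \/ i = 1.
  by case: i => [[|[|//]] hi]; [left|right]; apply/val_inj.
move: d; rewrite /det /cx /cy !mxE => d.
apply/matrixP => i j; rewrite !mxE big_ord_recl big_ord1.
have -> : lift ord0 ord0 = 1 :> 'I_2 by apply/val_inj.
have -> : (ord0 : 'I_2) = 0 by apply/val_inj.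
by rewrite !mxE /=; case: (e i) => ->; case: (e j) => -> /=; field.
Qed.

Lemma facet_two (P : set vec2) (u : vec2) c p q : u != 0 -> (forall z, P z -> dot u z <= c) ->
  P p -> P q -> p != q -> dot u p = c -> dot u q = c ->
  facet P [set z | P z /\ pairing u z = c].
Proof.
move=> nu hu Pp Pq ne ep eq; split.
  by exists u, c; split => // z; rewrite pairingE; apply: hu.
exists p, (q - p); split.
- by rewrite /row_free rank_rV subr_eq0 (eq_sym q) ne.
- by rewrite /= pairingE.
- move=> i; have -> : row i (q - p) = q - p by apply/rowP => j; rewrite !mxE ord1.
  by rewrite addrC subrK /= pairingE.
move=> z [_]; rewrite pairingE => ez; apply/sub_rVP.
(* The coefficient of the orthogonal projection onto [q - p]. It is exact because [u] annihilates
   both differences, which makes them parallel. *)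
exists (dot (q - p) (z - p) / dot (q - p) (q - p)).
have nd : dot (q - p) (q - p) != 0.
  rewrite /dot -!expr2 paddr_eq0 ?sqr_ge0 // !sqrf_eq0; apply: contra ne => /andP[/eqP a /eqP b].
  by rewrite eq_sym -subr_eq0; apply/eqP/vec2P; rewrite ?a ?b ?cE.
have dl : det (q - p) (z - p) = 0.
  apply/eqP/negPn/negP => d; case/eqP: nu; apply: (dot_inj d); rewrite /dot !cE;
  by move: ep eq ez; rewrite /dot; lra.
move: nd dl; move: (q - p) (z - p) => a b nd dl.
apply: vec2P; rewrite cE; apply: (mulfI nd); apply/eqP; rewrite -subr_eq0.
  have -> : dot a a * cx b - dot a a * (dot a b / dot a a * cx a) = - cy a * det a b.
    by move: nd; rewrite /dot /det => nd; field.
  by rewrite dl mulr0.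
have -> : dot a a * cy b - dot a a * (dot a b / dot a a * cy a) = cx a * det a b.
  by move: nd; rewrite /dot /det => nd; field.
by rewrite dl mulr0.
Qed.

Lemma facet_inv (P F : set vec2) : facet P F -> exists u c p q,
  [/\ forall z, P z -> dot u z <= c, F = [set z | P z /\ pairing u z = c],
      P p /\ P q, p != q & dot u p = c /\ dot u q = c] /\
  forall z, F z -> exists t, z = p + t *: (q - p).
Proof.
case=> -[u [c [hu eF]]] [p [A [fA Fp FA hF]]].
exists u, c, p, (p + A).
have rA : row 0 A = A by apply/rowP => j; rewrite !mxE.
have := FA 0; rewrite rA => Fq.
move: (Fp) (Fq); rewrite {1 2}eF /= !pairingE => -[Pp ep] [Pq eq].
split; first split => //.
- by move=> z; rewrite -pairingE; apply: hu.
- apply/eqP => e; move: fA; rewrite /row_free rank_rV.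
  by have -> : A = 0; [apply: (addrI p); rewrite -e addr0|rewrite eqxx].
- move=> z /hF /sub_rVP [t et]; exists t.
  have -> : p + A - p = A by rewrite addrAC subrr add0r.
  by rewrite -et addrC subrK.
Qed.

Lemma has_dim2 (P : set vec2) p q : P 0 -> P p -> P q -> det p q != 0 -> has_dim P 2.
Proof.
move=> P0 Pp Pq d.
pose A : 'M[rat]_2 := \matrix_(i < 2) (if i == 0 then p else q).
have r0 : row 0 A = p by rewrite rowK.
have r1 : row 1 A = q by rewrite rowK.
have fA : row_free A by apply: row_free_mx2; rewrite r0 r1.
exists 0, A; split => //.
  move=> i; rewrite add0r; case: i => [[|[|//]] hi].
    by have -> : Ordinal hi = 0 by [apply/val_inj]; rewrite r0.
  by have -> : Ordinal hi = 1 by [apply/val_inj]; rewrite r1.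
by move=> x _; apply: submx_full; rewrite /row_full -/(row_free A).
Qed.

Lemma segment_det0 (p q u v w : vec2) : (forall z, z = u \/ z = v \/ z = w -> exists t, z = p + t *: (q - p)) ->
  det (v - u) (w - u) = 0.
Proof.
move=> h; have [|r ->] := h u; first by left.
have [|s ->] := h v; first by right; left.
have [|t ->] := h w; first by right; right.
by rewrite /det !cE; ring.
Qed.

(** * Reflexivity of the image of a loop *)

Section Reflexive.
Variables (Q : seq pt) (W : pt * pt) (l : nat).
Hypotheses (gQ : goodloop Q) (l0 : (0 < l)%N) (dW : `|mdet W|%N = l).

Let on x := emb (onrm W (edge Q x)).
Let P := polygon Q W.

Let W0 : mdet W != 0. Proof. by rewrite -absz_gt0 dW. Qed.
Let lr0 : 0 < l%:R :> rat. Proof. by rewrite ltr0n. Qed.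

Lemma polygon0 : P 0.
Proof. by exists 0; [exact: polyhull0|vring]. Qed.

Lemma ap_emb_neq x : x \in Q -> ap W (emb x) != ap W (emb (next Q x)).
Proof. by move=> xQ; rewrite (can_eq (apK W0)) emb_next_neq. Qed.

Lemma polygon_polytope : polytope P.
Proof.
pose s := [seq ap W (emb x) | x <- Q].
exists (size s), (\matrix_i nth 0 s i); apply/funext => z; apply/propext.
rewrite conv_rows_hull.
have -> : [seq row i (\matrix_i nth 0 s i) | i <- enum 'I_(size s)] = s.
  under eq_map do rewrite rowK.
  by rewrite (map_comp (nth 0 s) val) val_enum_ord map_nth_iota0 // take_size.
split.
  case=> y hy <-; move: hy; apply: (@polyhull_sub _ (fun y => hull s (ap W y))).
    by move=> a b t ha hb ht; rewrite ap_comb; apply: hull_convex.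
  by move=> q qQ; apply: mem_hull; apply/mapP; exists q.
apply: (@hull_sub _ P).
  move=> _ _ t [a ha <-] [b hb <-] ht; exists ((1 - t) *: a + t *: b); last exact: ap_comb.
  exact: hull_convex.
by move=> _ /mapP[q qQ ->]; apply: polygon_mem.
Qed.

Lemma polygon_dim : has_dim P 2.
Proof.
apply: (@has_dim2 _ (ap W (emb (1, 0))) (ap W (emb (0, 1)))).
- exact: polygon0.
- exact/polygon_mem/good10.
- exact/polygon_mem/good01.
- by rewrite det_ap det_emb mulf_neq0 // intr_eq0.
Qed.

Lemma polygon_interior : origin_in_interior P.
Proof.
(* On the sup-norm ball of radius [l / m], a normal whose absolute coordinates sum to at most [m]
   has values at most [l]. *)
have [m m0 hm] := seq_ubound Q (fun x => `|cx (on x)| + `|cy (on x)|).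
exists (l%:R / m) => [|z hz]; first exact: divr_gt0.
apply/(polygonP gQ l0 dW) => x xQ; rewrite -/(on x).
have h0 := hz 0; have h1 := hz 1; rewrite -/(cx z) -/(cy z) in h0 h1.
have {}hm := hm x xQ; rewrite /dot.
have b a c : `|c| < l%:R / m -> a * c <= `|a| * (l%:R / m).
  move=> hc; apply: le_trans (ler_norm _) _; rewrite normrM.
  by apply: ler_wpM2l => //; apply: ltW.
have h2 := b (cx (on x)) _ h0; have h3 := b (cy (on x)) _ h1.
have e : l%:R = m * (l%:R / m) by field; rewrite gt_eqF.
have k0 : 0 <= l%:R / m by apply/ltW/divr_gt0.
have h4 : (`|cx (on x)| + `|cy (on x)|) * (l%:R / m) <= m * (l%:R / m) by apply: ler_wpM2r.
by rewrite e; lra.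
Qed.

Lemma polygon_facet F : facet P F ->
  exists x, x \in Q /\ F = [set z | P z /\ pairing (on x) z = l%:R].
Proof.
case/facet_inv => u [c [p [q [[hu eF [Pp Pq] ne [ep eq]] hF]]]].
(* For [u = 0] the face would be the whole polygon, which does not lie on a line. *)
have nu : u != 0.
  apply/eqP => u0; have d0 z : dot u z = 0 by rewrite u0 /dot !cE; ring.
  have all z : P z -> exists t, z = p + t *: (q - p).
    by move=> Pz; apply: hF; rewrite eF /=; split => //; rewrite pairingE d0 -ep d0.
  have : det (ap W (emb (1, 0)) - 0) (ap W (emb (0, 1)) - 0) = 0.
    apply: (@segment_det0 p q) => z [->|[]->]; apply: all; first exact: polygon0.
      exact/polygon_mem/good10.
    exact/polygon_mem/good01.
  by rewrite !subr0 det_ap det_emb; apply/eqP; rewrite mulf_neq0 // intr_eq0.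
have c0 : 0 < c.
  have [x xQ h] := polygon_dot_pos gQ l0 dW nu; apply: lt_le_trans h _; apply: hu; exact: polygon_mem.
have [x [xQ _ _ e]] := polygon_facet_edge gQ l0 dW c0 hu Pp Pq ne ep eq.
exists x; split => //; rewrite eF; apply/funext => z; apply/propext => /=; rewrite !pairingE.
have dZ a (v w : vec2) : dot (a *: v) w = a * dot v w by rewrite /dot !cE; ring.
have ez : l%:R * dot u z = c * dot (on x) z by rewrite -!dZ e.
split=> -[Pz h]; split => //.
  by apply: (mulfI (lt0r_neq0 c0)); rewrite -ez h mulrC.
by apply: (mulfI (lt0r_neq0 lr0)); rewrite ez h mulrC.
Qed.

Lemma on_neq0 x : x \in Q -> on x != 0.
Proof.
move=> xQ; apply/eqP => e; have := on_l gQ dW xQ; rewrite -/(on x) e /dot !cE !mul0r addr0.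
by move/esym/eqP; rewrite gt_eqF.
Qed.

(** Every facet is cut out by some [on x] at the constant [l], and a functional with value [l] at
    both ends of that edge equals [on x]. So the condition on local indices says that all [on x] are
    primitive. *)
Lemma reflexive_polygonP : reflexive_polygon l P <-> valid Q W.
Proof.
split.
- case=> _ _ prim fac; apply/allP => x xQ; apply/andP; split.
    apply/implyP => vx; apply/primitiveE; apply: prim; rewrite lat_zvec emb_mul.
    by apply/(polygon_vertices gQ l0 dW); exists x.
  have nQ : next Q x \in Q by rewrite mem_next.
  have := facet_two (on_neq0 xQ) (fun z => polygon_le gQ l0 dW xQ) (polygon_mem W xQ)
     (polygon_mem W nQ) (ap_emb_neq xQ) (on_l gQ dW xQ) (on_r gQ dW xQ).
  case/fac => _ [u [pu eF]].
  have h z : P z -> dot (on x) z = l%:R -> dot (lat u) z = l%:R.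
    move=> Pz ez; have : [set z | P z /\ pairing (on x) z = l%:R] z by split; rewrite // pairingE.
    by rewrite eF => -[_]; rewrite pairingE.
  have e1 := h _ (polygon_mem W xQ) (on_l gQ dW xQ).
  have e2 := h _ (polygon_mem W nQ) (on_r gQ dW xQ).
  have d : det (ap W (emb x)) (ap W (emb (next Q x))) != 0.
    by rewrite det_ap det_emb good_det // mul1r intr_eq0.
  have := dot_inj d (etrans (on_l gQ dW xQ) (esym e1)) (etrans (on_r gQ dW xQ) (esym e2)).
  by rewrite latE => /emb_inj ->; apply/primitiveE; rewrite -zvecE.
move=> /allP va; split.
- split; [exact: polygon_polytope|exact: polygon_dim|move=> v /(polygon_vertices gQ l0 dW)].
  by case=> x [xQ _ ->]; exists (zvec (mul x W)); rewrite lat_zvec emb_mul.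
- exact: polygon_interior.
- move=> z /(polygon_vertices gQ l0 dW) [x [xQ vx e]].
  have {}e : z = zvec (mul x W).
    by rewrite (zvecE z); congr zvec; apply: emb_inj; rewrite -latE e emb_mul.
  by rewrite e; apply/primitiveE; have /andP[/implyP] := va x xQ; move/(_ vx).
- move=> F /polygon_facet [x [xQ ->]]; split => //.
  exists (zvec (onrm W (edge Q x))); split; last by rewrite lat_zvec.
  by apply/primitiveE; have /andP[] := va x xQ.
Qed.

End Reflexive.

(** * Isomorphisms *)

Lemma isomorphic_sym P P' : isomorphic P P' -> isomorphic P' P.
Proof.
case=> A [b [uA e]]; exists (invmx A), (- (b *m invmx A)); split; first by rewrite unitmx_inv.
have K : lat A *m lat (invmx A) = 1%:M by rewrite /lat -map_mxM mulmxV // map_mx1.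
have c x : (x *m lat A + lat b) *m lat (invmx A) + lat (- (b *m invmx A)) = x.
  rewrite mulmxDl -mulmxA K mulmx1 /lat map_mxN map_mxM /= -addrA subrr addr0 //.
apply/funext => z; apply/propext; rewrite -e; split.
  by case=> _ [x vx <-] <-; rewrite c.
by move=> vz; exists (z *m lat A + lat b); [exists z|exact: c].
Qed.

Lemma isomorphic_trans P P' P'' : isomorphic P P' -> isomorphic P' P'' -> isomorphic P P''.
Proof.
case=> A [b [uA e]] [A' [b' [uA' e']]].
exists (A *m A'), (b *m A' + b'); split; first by rewrite unitmx_mul uA.
have c x : x *m lat (A *m A') + lat (b *m A' + b') = (x *m lat A + lat b) *m lat A' + lat b'.
  by rewrite /lat mulmxDl -mulmxA -!map_mxM map_mxD addrA.
rewrite -e' -e; apply/funext => z; apply/propext; split.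
  by case=> x vx <-; exists (x *m lat A + lat b); [exists x|rewrite c].
by case=> _ [x vx <-] <-; exists x; rewrite ?c.
Qed.

Definition of_mx (A : 'M[int]_2) : pt * pt := ((A 0 0, A 0 1), (A 1 0, A 1 1)).

Lemma det_of_mx A : \det A = mdet (of_mx A).
Proof.
rewrite (expand_det_row _ 0) big_ord_recl big_ord1 /cofactor !det_mx11 !mxE /= /mdet /idet /=.
have e (i j : 'I_2) : val i = val j -> i = j by exact: val_inj.
rewrite (e (lift ord0 ord0) 1) // (e (lift 1 0) 0) // ?(e (lift 0 0) 1) //.
by rewrite expr0 expr1; ring.
Qed.

Lemma mulmx_ap (A : 'M[int]_2) x : x *m lat A = ap (of_mx A) x.
Proof.
by apply: vec2P; rewrite cE /cx /cy !mxE big_ord_recl big_ord1 !mxE /=;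
  (have -> : lift ord0 ord0 = 1 :> 'I_2 by apply/val_inj);
  (have -> : (ord0 : 'I_2) = 0 by apply/val_inj).
Qed.

Lemma isomorphicP (P P' : set vec2) : isomorphic P P' <-> exists (A : pt * pt) (b : pt),
  `|mdet A|%N = 1%N /\ [set ap A x + emb b | x in vertices P] = vertices P'.
Proof.
have uE (A : 'M[int]_2) : (A \in unitmx) = (`|mdet (of_mx A)|%N == 1%N).
  by rewrite unitmxE det_of_mx; move: (mdet _) => d; apply/idP/eqP; rewrite -[_ \is a _]/((d == 1) || (d == -1)); lia.
split=> [[A [b [uA e]]]|[A [b [dA e]]]].
  exists (of_mx A), (b 0 0, b 0 1); split.
    by apply/eqP; rewrite -uE.
  by rewrite -e; apply: eq_imagel => x _; rewrite mulmx_ap latE.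
pose B : 'M[int]_2 := \matrix_(i < 2, j < 2) zvec (if i == 0 then A.1 else A.2) 0 j.
have eB : of_mx B = A.
  by rewrite /of_mx /B; case: (A) => -[? ?] [? ?]; congr (_, _, (_, _)); rewrite !mxE.
exists B, (zvec b); split; first by rewrite uE eB dA.
by rewrite -e; apply: eq_imagel => x _; rewrite mulmx_ap eB lat_zvec.
Qed.

(* The base changes [S] of the lattice (given by the images of [(1, 0)] and
   [(0, 1)]) that map [Q'] into [Q] and [(1, 0)] to a vertex. *)
Definition maps (Q Q' : seq pt) : seq (pt * pt) :=
  [seq S <- [seq (x, y) | x <- Q, y <- Q] |
    [&& `|mdet S|%N == 1%N, all (fun q => mul q S \in Q) Q' & vtx Q S.1]].

Lemma mapsP Q Q' S : S \in maps Q Q' <-> [/\ S.1 \in Q, S.2 \in Q, vtx Q S.1,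
  `|mdet S|%N = 1%N & forall q, q \in Q' -> mul q S \in Q].
Proof.
rewrite mem_filter; split.
  case/andP => /and3P[/eqP d /allP h v] /allpairsP[[x y] /= [xQ yQ e]].
  by rewrite e in v d h *; split.
case=> xQ yQ v d h; apply/andP; split; first by rewrite v d eqxx andbT /=; apply/allP.
by apply/allpairsP; exists S; split=> //; case: (S).
Qed.

Lemma absz1 (d : int) : `|d|%N = 1%N -> d = 1 \/ d = -1.
Proof. lia. Qed.

Lemma cop_mul p A : `|mdet A|%N = 1%N -> cop p -> cop (mul p A).
Proof.
move=> dA /copP [u [v e]]; apply/copP.
exists (mdet A * (u * A.2.2 - v * A.1.2)), (mdet A * (v * A.1.1 - u * A.2.1)).
have -> : mdet A * (u * A.2.2 - v * A.1.2) * (mul p A).1 +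
   mdet A * (v * A.1.1 - u * A.2.1) * (mul p A).2 = mdet A * mdet A * (u * p.1 + v * p.2).
  by rewrite /mul /mdet /idet /=; ring.
by rewrite e; case/absz1: dA => ->.
Qed.

(** Bezout relations for the two primitive vectors show that each factor divides the other. *)
Lemma cop_scale (a b : int) p q : cop p -> cop q -> 0 < a -> 0 < b ->
  a * p.1 = b * q.1 -> a * p.2 = b * q.2 -> a = b.
Proof.
move=> /copP[u [v e]] /copP[u' [v' e']] a0 b0 e1 e2.
have ea : a = b * (u * q.1 + v * q.2).
  transitivity (u * (a * p.1) + v * (a * p.2)); last by rewrite e1 e2; ring.
  transitivity (a * (u * p.1 + v * p.2)); [by rewrite e mulr1|ring].
have eb : b = a * (u' * p.1 + v' * p.2).
  transitivity (u' * (b * q.1) + v' * (b * q.2)); last by rewrite -e1 -e2; ring.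
  transitivity (b * (u' * q.1 + v' * q.2)); [by rewrite e' mulr1|ring].
have dab : (b %| a)%Z by rewrite ea dvdz_mulr.
have dba : (a %| b)%Z by rewrite eb dvdz_mulr.
move: dab dba; rewrite /dvdz => d1 d2.
have : `|a|%N = `|b|%N by apply/eqP; rewrite eqn_dvd; apply/andP.
by lia.
Qed.

Lemma polyhull_image Q S y : polyhull [seq mul q S | q <- Q] y <->
  exists2 z, polyhull Q z & ap S z = y.
Proof.
split.
  apply: (@polyhull_sub _ (fun y => exists2 z, polyhull Q z & ap S z = y)).
    move=> _ _ t [a ha <-] [b hb <-] ht; exists ((1 - t) *: a + t *: b); last exact: ap_comb.
    exact: hull_convex.
  move=> _ /mapP[q qQ ->]; exists (emb q); [exact: mem_polyhull|by rewrite emb_mul].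
case=> z hz <-; move: hz; apply: (@polyhull_sub _ (fun z => polyhull _ (ap S z))).
  by move=> a b t ha hb ht; rewrite ap_comb; apply: hull_convex.
by move=> q qQ; rewrite -emb_mul; apply: mem_polyhull; apply/mapP; exists q.
Qed.

Lemma absz_neq0 (d : int) : `|d|%N = 1%N -> d != 0. Proof. lia. Qed.

Lemma mul_inj S : mdet S != 0 -> injective (mul^~ S).
Proof.
move=> S0 p q e; apply/emb_inj/(can_inj (apK S0)).
by rewrite -!emb_mul; congr emb.
Qed.

(** Membership in [maps] only says that [S] sends [Q'] into [Q]; injectivity and equal sizes make it
    a bijection. *)
Lemma polygon_rebase Q Q' S W : goodloop Q -> goodloop Q' -> size Q' = size Q ->
  S \in maps Q Q' -> polygon Q W = polygon Q' (mulM S W).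
Proof.
move=> gQ gQ' sz /mapsP [_ _ _ /absz_neq0 dS h].
have u : uniq [seq mul q S | q <- Q'].
  by rewrite map_inj_uniq ?(good_uniq gQ') //; apply: mul_inj.
have sub : {subset [seq mul q S | q <- Q'] <= Q} by move=> _ /mapP[q qQ ->]; apply: h.
have [|_ e] := uniq_min_size u sub; first by rewrite size_map sz.
have eh y : polyhull Q y <-> exists2 z, polyhull Q' z & ap S z = y.
  rewrite -polyhull_image; apply: hull_eq_mem => v; apply/mapP/mapP => -[q qQ ->];
  by exists q => //; rewrite ?e // -e.
apply/funext => z; apply/propext; split.
  by case=> _ /eh [y hy <-] <-; exists y => //; rewrite ap_mulM.
by case=> y hy <-; exists (ap S y); rewrite ?ap_mulM //; apply/eh; exists y.
Qed.

Lemma polygon_ap Q W A : polygon Q (mulM W A) = [set ap A z | z in polygon Q W].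
Proof.
apply/funext => z; apply/propext; split.
  by case=> y hy <-; exists (ap W y); rewrite ?ap_mulM //; exists y.
by case=> _ [y hy <-] <-; exists y; rewrite ?ap_mulM.
Qed.

Lemma emb0 : emb (0, 0) = 0. Proof. by apply: vec2P; rewrite !ceE. Qed.

Lemma isomorphic_polygon Q W A : `|mdet A|%N = 1%N ->
  isomorphic (polygon Q W) (polygon Q (mulM W A)).
Proof.
move=> dA; apply/isomorphicP; exists A, (0, 0); split => //; rewrite emb0 polygon_ap.
have d0 := absz_neq0 dA.
have e0 : [set ap A z | z in polygon Q W] = [set ap A z + 0 | z in polygon Q W].
  by apply: eq_imagel => z _; rewrite addr0.
rewrite e0; apply/funext => z; apply/propext; split.
  by case=> v hv <-; apply/(@extreme_ap A 0 (polygon Q W) v d0).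
move=> hz; have [v hv ev] : [set ap A z + 0 | z in polygon Q W] z by case: hz.
exists v => //; apply/(@extreme_ap A 0 (polygon Q W) v d0); rewrite ev; exact: hz.
Qed.

Lemma polygon_convex Q W : convex_pred (polygon Q W).
Proof.
move=> _ _ t [a ha <-] [b hb <-] ht; exists ((1 - t) *: a + t *: b); last exact: ap_comb.
exact: hull_convex.
Qed.

Section Isomorphism.
Variables (Q Q' : seq pt) (W W' : pt * pt) (l : nat).
Hypotheses (gQ : goodloop Q) (gQ' : goodloop Q') (l0 : (0 < l)%N).
Hypotheses (dW : `|mdet W|%N = l) (dW' : `|mdet W'|%N = l).
Hypotheses (vQ : valid Q W) (vQ' : valid Q' W').

Let W0 : mdet W != 0. Proof. by rewrite -absz_gt0 dW. Qed.
Let W0' : mdet W' != 0. Proof. by rewrite -absz_gt0 dW'. Qed.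

(** Isomorphisms are given on vertices only; since each polygon is the hull of its extreme points,
    the equality spreads to the polygons. *)
Lemma vertices_image A b :
  [set ap A x + emb b | x in vertices (polygon Q W)] = vertices (polygon Q' W') ->
  [set ap A x + emb b | x in polygon Q W] = polygon Q' W'.
Proof.
move=> e; apply/funext => z; apply/propext; split.
  case=> _ [y hy <-] <-; have [s [hs eh]] := hull_extreme (map emb Q).
  have {}hy : hull s y by apply/eh.
  move: hy; apply: (@hull_sub _ (fun y => polygon Q' W' (ap A (ap W y) + emb b))).
    move=> u v t hu hv ht; rewrite !ap_comb.
    have -> : (1 - t) *: ap A (ap W u) + t *: ap A (ap W v) + emb b =
      (1 - t) *: (ap A (ap W u) + emb b) + t *: (ap A (ap W v) + emb b) by vring.
    exact: polygon_convex.
  move=> v /hs hv; suff : vertices (polygon Q' W') (ap A (ap W v) + emb b) by case.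
  rewrite -e; exists (ap W v) => //; apply/(polygon_vertices gQ l0 dW).
  by have [x [xQ vx ->]] := extreme_polyhull gQ hv; exists x.
case=> y hy <-; have [s [hs eh]] := hull_extreme (map emb Q').
have {}hy : hull s y by apply/eh.
move: hy; apply: (@hull_sub _ (fun y => [set ap A x + emb b | x in polygon Q W] (ap W' y))).
  move=> u v t [u' hu eu] [v' hv ev] ht; exists ((1 - t) *: u' + t *: v').
    exact: polygon_convex.
  by rewrite !ap_comb -eu -ev; vring.
move=> v /hs hv; have : vertices (polygon Q' W') (ap W' v).
  apply/(polygon_vertices gQ' l0 dW').
  by have [x [xQ vx ->]] := extreme_polyhull gQ' hv; exists x.
by rewrite -e => -[x [px _] ex]; exists x.
Qed.

(* A translation part would shift the constant of a primitive normal, but all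
   these constants are equal to [l]. *)
Lemma isomorphic_translation A b : `|mdet A|%N = 1%N ->
  [set ap A x + emb b | x in polygon Q W] = polygon Q' W' -> b = (0, 0).
Proof.
move=> dA e; have A0 := absz_neq0 dA; apply/eqP/negPn/negP => nb.
have key x : x \in Q' -> idot (onrm W' (edge Q' x)) b = 0.
  move=> xQ'; set u := onrm _ _.
  have cu : cop u by have /allP/(_ x xQ')/andP[] := vQ'.
  (* Pulling [u] back along [A] is multiplication by the transpose, so [u'] is again primitive; it
     supports the first polygon at the level [c], shifted by the value of [u] at [b]. *)
  pose At : pt * pt := ((A.1.1, A.2.1), (A.1.2, A.2.2)).
  have dAt : `|mdet At|%N = 1%N by rewrite -dA /mdet /idet /= [A.2.1 * _]mulrC.
  have cu' := cop_mul dAt cu; set u' := mul u At in cu'.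
  have du z : dot (emb u) (ap A z + emb b) = dot (emb u') z + (idot u b)%:~R.
    by rewrite /dot /u' /idot !ceE /=; ring.
  pose c : int := l%:Z - idot u b.
  have le z : polygon Q W z -> dot (emb u') z <= c%:~R.
    move=> hz; have : polygon Q' W' (ap A z + emb b) by rewrite -e; exists z.
    move/(polygon_le gQ' l0 dW' xQ'); rewrite du /c rmorphB /=; lra.
  have pre y : y \in Q' -> dot (emb u) (ap W' (emb y)) = l%:R ->
      exists z, [/\ polygon Q W z, ap A z + emb b = ap W' (emb y) & dot (emb u') z = c%:~R].
    move=> yQ' ey; have := polygon_mem W' yQ'; rewrite -e => -[z hz ez]; exists z; split => //.
    by move: ey; rewrite -ez du /c rmorphB /= => ey; rewrite -[l%:~R]/(l%:R) -ey addrK.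
  have [z0 [h0 e0 f0]] := pre _ xQ' (on_l gQ' dW' xQ').
  have nQ' : next Q' x \in Q' by rewrite mem_next.
  have [z1 [h1 e1 f1]] := pre _ nQ' (on_r gQ' dW' xQ').
  have ne : z0 != z1.
    apply: contra (ap_emb_neq gQ' l0 dW' xQ') => /eqP ez.
    by rewrite -e0 -e1 ez.
  have nu' : emb u' != 0.
    rewrite -emb0 (inj_eq emb_inj); apply: contraL cu' => /eqP ->.
    by apply/negP => /copP [? [?]]; rewrite !mulr0 addr0.
  have c0 : 0 < c%:~R :> rat.
    have [y yQ hy] := polygon_dot_pos gQ l0 dW nu'.
    exact: lt_le_trans hy (le _ (polygon_mem W yQ)).
  (* The segment from [z0] to [z1] lies on an edge whose primitive normal [v] has constant [l], so
     that [l u' = c v], which forces [c = l]. *)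
  have [y [yQ _ _ ey]] := polygon_facet_edge gQ l0 dW c0 le h0 h1 ne f0 f1.
  set v := onrm W (edge Q y) in ey.
  have cv : cop v by have /allP/(_ y yQ)/andP[] := vQ.
  have : l%:Z = c.
    apply: (cop_scale cu' cv) => //; first by rewrite -(ltr0z rat).
      by apply: (@intr_inj rat); have := congr1 cx ey; rewrite !ceE !rmorphM.
    by apply: (@intr_inj rat); have := congr1 cy ey; rewrite !ceE !rmorphM.
  by move/eqP; rewrite /c -subr_eq0 subKr => /eqP.
(* All edge normals vanish at [b], whereas [cover] gives one that is positive at any nonzero
   vector. *)
have nb' : apV W' (emb b) != 0.
  apply: contra nb => /eqP eb; apply/eqP/emb_inj; rewrite -(apVK W0' (emb b)) eb emb0; vring.
have [x [xQ' a0 b0 _ ex]] := cover gQ' nb'.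
have := dot_on Q' dW' x (apV W' (emb b)); rewrite apVK // dot_emb key // ex.
have lr0 : 0 < l%:R :> rat by rewrite ltr0n.
by move/esym/eqP; rewrite mulf_eq0 !gt_eqF // ltr_wpDr.
Qed.

(** The preimage [y1] of [(0, 1)] in the coordinates of [Q] is a priori only rational. But it shares
    an edge of [Q] with the vertex [x0] and has determinant 1 or -1 with it, so it is one edge step
    away from [x0] and thus integral. *)
Lemma isomorphic_maps : next Q' (1, 0) = (0, 1) -> vtx Q' (1, 0) ->
  isomorphic (polygon Q W) (polygon Q' W') ->
  exists S A, [/\ S \in maps Q Q', `|mdet A|%N = 1%N & mulM S (mulM W A) = W'].
Proof.
move=> n10 v10 /isomorphicP [A [b [dA ev]]].
have e := vertices_image ev; have b0 := isomorphic_translation dA e.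
have A0 := absz_neq0 dA.
move: ev e; rewrite b0 emb0 => ev e.
have Q10 := good10 gQ'; have Q01 := good01 gQ'.
have [x0 [x0Q vx0 ex0]] : exists x0, [/\ x0 \in Q, vtx Q x0 & ap A (ap W (emb x0)) = ap W' (emb (1, 0))].
  have : vertices (polygon Q' W') (ap W' (emb (1, 0))).
    by apply/(polygon_vertices gQ' l0 dW'); exists (1, 0).
  rewrite -ev => -[_ /(polygon_vertices gQ l0 dW) [x [xQ vx ->]] ex].
  by exists x; split => //; rewrite -ex addr0.
have pre y : polyhull Q' y -> exists2 z, polyhull Q z & ap A (ap W z) = ap W' y.
  move=> hy; have : polygon Q' W' (ap W' y) by exists y.
  by rewrite -e => -[_ [z hz <-] <-]; exists z => //; rewrite addr0.
have [y1 hy1 ey1] := pre _ (mem_polyhull Q01).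
have lr0 : 0 < l%:R :> rat by rewrite ltr0n.
have dWA : mdet (mulM W A) != 0 by rewrite mdetM mulf_neq0.
have injWA y z : ap A (ap W y) = ap A (ap W z) -> y = z.
  by rewrite -!ap_mulM => /(can_inj (apK dWA)).
pose u := emb (onrm W' (edge Q' (1, 0))).
pose u' := vec (cx u * A.1.1%:~R + cy u * A.1.2%:~R) (cx u * A.2.1%:~R + cy u * A.2.2%:~R).
have du z : dot u (ap A z) = dot u' z by rewrite /dot /u' !cE; ring.
have le z : polygon Q W z -> dot u' z <= l%:R.
  move=> hz; rewrite -du; apply: (polygon_le gQ' l0 dW' Q10).
  by rewrite -e; exists z; rewrite ?addr0.
have f0 : dot u' (ap W (emb x0)) = l%:R by rewrite -du ex0; apply: (on_l gQ' dW').
have f1 : dot u' (ap W y1) = l%:R.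
  by rewrite -du ey1 -n10; apply: (on_r gQ' dW').
have ne : ap W (emb x0) != ap W y1.
  apply/eqP => e1; have := ap_emb_neq gQ' l0 dW' Q10.
  by rewrite n10 -ex0 -ey1 e1 eqxx.
have hy1' : polygon Q W (ap W y1) by exists y1.
have [x [xQ g0 g1 _]] := polygon_facet_edge gQ l0 dW lr0 le (polygon_mem W x0Q) hy1' ne f0 f1.
have {}g0 : dot (emb (edge Q x)) (emb x0) = 1.
  by apply: (mulfI (lt0r_neq0 lr0)); rewrite mulr1 -(dot_on Q dW).
have {}g1 : dot (emb (edge Q x)) y1 = 1.
  by apply: (mulfI (lt0r_neq0 lr0)); rewrite mulr1 -(dot_on Q dW).
(* [W] and [W'] have determinants of equal absolute value; the sign stays open because orientation
   may be reversed. *)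
have dd : det (emb x0) y1 = 1 \/ det (emb x0) y1 = -1.
  have := congr2 det ex0 ey1; have i1 : idet (1, 0) (0, 1) = 1 by [].
  rewrite !det_ap det_emb i1 mul1r => h.
  have : `|det (emb x0) y1| = 1.
    have la (k : int) : `|k%:~R| = (`|k|%N : int)%:~R :> rat by rewrite -intr_norm abszE.
    have eA : (`|mdet A|%N : int)%:~R = 1 :> rat by rewrite dA.
    move/(congr1 Num.norm): h; rewrite !normrM !la eA dW dW' mulr1 => h.
    apply: (mulIf (lt0r_neq0 lr0)); rewrite !pmulrn h.
    by rewrite mul1r.
  by move/eqP; rewrite eqr_norml ler01 andbT => /orP[] /eqP; [left|right].
pose d : pt := ((next Q x).1 - x.1, (next Q x).2 - x.2).
(* Two points at which the edge normal is 1 differ by their determinant times the edge step [d]. *)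
have [eps ey] : exists eps : int, y1 = emb (x0.1 + eps * d.1, x0.2 + eps * d.2).
  suff h : y1 = emb x0 + det (emb x0) y1 *: emb d.
    by case: dd => ee; [exists 1|exists (-1)]; rewrite h ee; apply: vec2P; rewrite !ceE /=; ring.
  have lin (p q r s c k : rat) : k * p + c * q = 1 -> k * r + c * s = 1 ->
      r = p + (p * s - q * r) * - c /\ s = q + (p * s - q * r) * k.
    move=> h0 h1; split; apply/eqP; rewrite -subr_eq0.
      have -> : r - (p + (p * s - q * r) * - c) = p * ((k * r + c * s) - 1) - r * ((k * p + c * q) - 1) by ring.
      by rewrite h0 h1 subrr !mulr0 subrr.
    have -> : s - (q + (p * s - q * r) * k) = q * ((k * r + c * s) - 1) - s * ((k * p + c * q) - 1) by ring.
    by rewrite h0 h1 subrr !mulr0 subrr.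
  have [e1 e2] := lin _ _ _ _ _ _ g0 g1.
  by apply: vec2P; rewrite /det !ceE /=; [rewrite {1}e1|rewrite {1}e2];
    rewrite /edge /nrm !ceE /= !rmorphB /=; ring.
set q1 : pt := (_, _) in ey.
have q1Q : q1 \in Q.
  apply: (polyhull_int gQ); last by rewrite -ey.
  apply/eqP => q0; move: g1; rewrite ey q0 emb0 /dot !cE !mulr0 addr0.
  by move/esym/eqP; rewrite oner_eq0.
have dS : `|mdet (x0, q1)|%N = 1%N.
  by move: dd; rewrite ey det_emb /mdet /= -[1]/(1%:~R) -[-1]/((-1)%:~R) => -[] /intr_inj ->.
exists (x0, q1), A; split => //.
  apply/mapsP; split => // q qQ'; apply: (polyhull_int gQ).
    have n0 : (0, 0) \notin Q'.
      by apply/negP => /(good_det gQ'); rewrite /idet /= !mul0r.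
    apply: contra n0 => /eqP eq0; suff <- : q = (0, 0) by [].
    by apply: (mul_inj (absz_neq0 dS)); rewrite /= eq0 /mul /= !mul0r.
  have [z hz ez] := pre _ (mem_polyhull qQ').
  suff -> : emb (mul q (x0, q1)) = z by [].
  apply: injWA; rewrite ez emb_mul.
  have -> : ap (x0, q1) (emb q) = q.1%:~R *: emb x0 + q.2%:~R *: emb q1.
    by apply: vec2P; rewrite !ceE.
  rewrite !ap_comb ex0 -ey ey1; apply: vec2P; rewrite !ceE /=; ring.
have h1 : mul x0 (mulM W A) = W'.1.
  apply: emb_inj; rewrite mul_mulM !emb_mul ex0; apply: vec2P; rewrite !ceE /=; ring.
have h2 : mul q1 (mulM W A) = W'.2.
  apply: emb_inj; rewrite mul_mulM !emb_mul -ey ey1; apply: vec2P; rewrite !ceE /=; ring.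
by rewrite {1}/mulM h1 h2; case: (W').
Qed.
End Isomorphism.

(** * Enumeration *)

Definition next_point (k : int) (p q : pt) : pt := (k * p.1 - q.1, k * p.2 - q.2).

(* The bound 5 on collinear steps, see [walk_straight], makes the search finite. *)
Definition straight5 (s : seq pt) : bool :=
  if s is [:: z, a, _, _, _, e & _]
  then (z.1 - e.1 == 5%:Z * (z.1 - a.1)) && (z.2 - e.2 == 5%:Z * (z.2 - a.2)) else false.

(** The list runs backwards, so [e.2] precedes [e.1] on the walk. Both tests hold for every prefix
    of a walk around a polygon, see [walk_prefix_ok], so the pruning loses nothing. *)
Definition prefix_ok (s : seq pt) : bool :=
  ~~ straight5 s &&
  all (fun e => all (fun y => idot (nrm e.2 e.1) y <= 1) s) (zip s (behead s)).

(* Extends the walk [p :: q :: s] (last point first) until it returns to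
   [(1, 0)]; a walk that runs out of fuel shows up as the empty loop. *)
Fixpoint search (fuel : nat) (p q : pt) (s : seq pt) : seq (seq pt) :=
  if fuel is n.+1 then
    flatten [seq (let z := next_point k p q in
      if prefix_ok [:: z, p, q & s] then
        if z == (1, 0) then [:: rev [:: p, q & s]] else search n z p (q :: s)
      else [::]) | k <- [:: -2; -1; 0; 1; 2]]
  else [:: [::]].

(** The 1-reflexive polygons up to isomorphism, each in a basis for which its loop starts at a
    vertex [(1, 0)] and goes on to [(0, 1)], as [isomorphic_maps] requires. *)
Definition reps : seq (seq pt) := [::
  [:: (1, 0); (0, 1); (-1, -2); (0, -1)];
  [:: (1, 0); (0, 1); (-1, -1)];
  [:: (1, 0); (0, 1); (-1, -1); (0, -1)];
  [:: (1, 0); (0, 1); (-1, -1); (0, -1); (1, -1)];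
  [:: (1, 0); (0, 1); (-1, -1); (-2, -3); (-1, -2); (0, -1)];
  [:: (1, 0); (0, 1); (-1, 0); (0, -1)];
  [:: (1, 0); (0, 1); (-1, 0); (0, -1); (1, -1)];
  [:: (1, 0); (0, 1); (-1, 0); (0, -1); (1, -2); (1, -1)];
  [:: (1, 0); (0, 1); (-1, 0); (-1, -1); (0, -1); (1, -1)];
  [:: (1, 0); (0, 1); (-1, 0); (-2, -1); (-1, -1); (0, -1); (1, -1)];
  [:: (1, 0); (0, 1); (-1, 1); (-1, 0); (0, -1); (1, -1)];
  [:: (1, 0); (0, 1); (-1, 1); (-1, 0); (0, -1); (1, -2); (1, -1)];
  [:: (1, 0); (0, 1); (-1, 1); (-2, 1); (-1, 0); (0, -1); (1, -2); (1, -1)];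
  [:: (1, 0); (0, 1); (-1, 2); (0, -1); (1, -4); (1, -3); (1, -2); (1, -1)];
  [:: (1, 0); (0, 1); (-1, 2); (-1, 1); (-1, 0); (0, -1); (1, -2); (1, -1)];
  [:: (1, 0); (0, 1); (-1, 2); (-2, 3); (-1, 1); (0, -1); (1, -3); (1, -2); (1, -1)]].

(** This also certifies that the fuel 12 is enough: the empty loop is not good, so no walk has run
    out. *)
Lemma search_loops : all (fun Q => goodloop Q &&
    has (fun Q0 => (size Q0 == size Q) && ~~ nilp (maps Q Q0)) reps)
  (search 12 (0, 1) (1, 0) [::]).
Proof. by vm_compute. Qed.

Lemma reps_good : all (fun Q => [&& goodloop Q, next Q (1, 0) == (0, 1) & vtx Q (1, 0)]) reps.
Proof. by vm_compute. Qed.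

(** An isomorphism of images yields base changes in both directions, so one empty direction
    separates two loops. *)
Lemma reps_distinct : all (fun Q => all (fun Q' =>
  [|| Q == Q', nilp (maps Q Q') | nilp (maps Q' Q)]) reps) reps.
Proof. by vm_compute. Qed.

(** * Hermite normal forms and the action on their parameters *)

Definition hnf (l c : nat) : pt * pt := ((1, 0), (c%:Z, l%:Z)).

(* If [(1, 0)] and [(0, 1)] are replaced by the rows of [S], then the Hermite
   normal form with parameter [c] becomes the one with parameter
   [(S21 + S22 c) / (S11 + S12 c)] modulo [l]. *)
Definition mob (l : nat) (S : pt * pt) (c : nat) : nat :=
  let u := `|((S.1.1 + S.1.2 * c%:Z)%R %% l)%Z|%N in
  let v := `|((S.2.1 + S.2.2 * c%:Z)%R %% l)%Z|%N in
  (v * (egcdn u l).1) %% l.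

(** Comparing [c] with single moves suffices: any isomorphism between two images of the same loop
    comes from one element of [M]. *)
Definition min_code (l : nat) (Q : seq pt) (M : seq (pt * pt)) (c : nat) : bool :=
  valid Q (hnf l c) && all (fun S => c <= mob l S c)%N M.

(** The [let] lets the automorphisms be computed once for each loop instead of once for each [c]. *)
Definition codes (l : nat) : seq (seq pt * nat) :=
  [seq (Q, c) | Q <- reps, c <- (let M := maps Q Q in [seq c <- iota 0 l | min_code l Q M c])].

Lemma normal_form l W : (0 < l)%N -> `|mdet W|%N = l -> cop W.1 ->
  exists A c, [/\ `|mdet A|%N = 1%N, (c < l)%N & mulM W A = hnf l c].
Proof.
move=> l0 dW /copP [u [v e]]; set s : int := sgz (mdet W).
have s1 : s * mdet W = l%:Z by rewrite -dW /s abszEsg.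
have ns : `|s|%N = 1%N by apply/eqP; rewrite -(eqn_pmul2r l0) mul1n -{1}dW -abszM s1 absz_nat.
pose c0 := W.2.1 * u + W.2.2 * v; pose m := (c0 %/ l%:Z)%Z.
(* The second column is the first row of [W] turned by a right angle, signed so that the corner
   entry becomes [+l]. The first column is a Bezout vector minus [m] times the second, which reduces
   [c0] modulo [l]. *)
exists ((u - m * (s * - W.1.2), s * - W.1.2), (v - m * (s * W.1.1), s * W.1.1)), `|(c0 %% l%:Z)%Z|%N.
have lz : l%:Z != 0 by lia.
have c1 : `|(c0 %% l%:Z)%Z|%N = (c0 %% l%:Z)%Z :> int by rewrite abszE ger0_norm // modz_ge0.
split.
- rewrite /mdet /idet /=.
  have -> : (u - m * (s * - W.1.2)) * (s * W.1.1) - s * - W.1.2 * (v - m * (s * W.1.1)) =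
     s * (u * W.1.1 + v * W.1.2) by ring.
  by rewrite e mulr1.
- by rewrite -ltz_nat c1 ltz_pmod.
rewrite /mulM /hnf c1; congr (_, _); congr (_, _) => /=.
- have -> : W.1.1 * (u - m * (s * - W.1.2)) + W.1.2 * (v - m * (s * W.1.1)) =
    u * W.1.1 + v * W.1.2 by ring.
  exact: e.
- by ring.
- have -> : W.2.1 * (u - m * (s * - W.1.2)) + W.2.2 * (v - m * (s * W.1.1)) =
    c0 - m * (s * mdet W) by rewrite /c0 /mdet /idet; ring.
  by rewrite s1 {1}(divz_eq c0 l%:Z) -/m addrAC subrr add0r.
- by rewrite -s1 /mdet /idet; ring.
Qed.

(** Modulo [l] the first column of the equation reads [u * A.1.1 = 1] and [v * A.1.1 = c'], so [c']
    is [v / u]. *)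
Lemma mobP l S c c' A : (0 < l)%N -> (c' < l)%N -> `|mdet A|%N = 1%N ->
  mulM (mulM S (hnf l c)) A = hnf l c' -> c' = mob l S c.
Proof.
move=> l0 c'l dA; rewrite /mulM /hnf /mul /= => -[e1 e2 e3 e4].
set a := S.1.1 in e1 e2 e3 e4 *; set b := S.1.2 in e1 e2 e3 e4 *.
set d := S.2.1 in e1 e2 e3 e4 *; set f := S.2.2 in e1 e2 e3 e4 *.
rewrite /mob -/a -/b -/d -/f.
set u := (a + b * c%:Z)%R; set v := (d + f * c%:Z)%R.
have lz : l%:Z != 0 by lia.
have hc : coprime `|(u %% l)%Z|%N l.
  have : coprimez u l.
    apply/coprimezP; exists (A.1.1, b * A.2.1) => /=.
    by rewrite -e1 /u; ring.
  by rewrite /coprimez -gcdz_modl /gcdz /= /coprime.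
have hd : (l %| v - c'%:Z * u)%Z.
  apply/dvdzP; exists (- A.2.1 * mdet A).
  have A1 : mdet A * mdet A = 1 by case/absz1: dA => ->.
  (* The second row minus [c'] times the first is sent by [A] to [(0, l)]; the adjugate of [A] then
     recovers [v - c' u] as a multiple of [l]. *)
  have h1 : (v - c'%:Z * u) * A.1.1 + (f - c'%:Z * b) * l * A.2.1 = 0.
    transitivity ((d * 1 + f * c) * A.1.1 + (d * 0 + f * l) * A.2.1
      - c'%:Z * ((a * 1 + b * c) * A.1.1 + (a * 0 + b * l) * A.2.1)).
      by rewrite /u /v; ring.
    by rewrite e1 e3; ring.
  have h2 : (v - c'%:Z * u) * A.1.2 + (f - c'%:Z * b) * l * A.2.2 = l.
    transitivity ((d * 1 + f * c) * A.1.2 + (d * 0 + f * l) * A.2.2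
      - c'%:Z * ((a * 1 + b * c) * A.1.2 + (a * 0 + b * l) * A.2.2)).
      by rewrite /u /v; ring.
    by rewrite e2 e4; ring.
  transitivity ((v - c'%:Z * u) * (mdet A * mdet A)); first by rewrite A1 mulr1.
  transitivity (mdet A * (((v - c'%:Z * u) * A.1.1 + (f - c'%:Z * b) * l * A.2.1) * A.2.2 -
     ((v - c'%:Z * u) * A.1.2 + (f - c'%:Z * b) * l * A.2.2) * A.2.1)).
    by rewrite /mdet /idet; ring.
  by rewrite h1 h2; ring.
set U := `|(u %% l)%Z|%N in hc *; set V := `|(v %% l)%Z|%N.
have cU : U%:Z = (u %% l)%Z by rewrite abszE ger0_norm // modz_ge0.
have cV : V%:Z = (v %% l)%Z by rewrite abszE ger0_norm // modz_ge0.
have {hd}hd : V = c' * U %[mod l].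
  move: hd; rewrite -eqz_mod_dvd => /eqP hd; apply/eqP; rewrite -eqz_nat -!modz_nat.
  by rewrite PoszM cU cV modz_mod hd modzMmr.
rewrite -modnMml hd modnMml -mulnA.
(* [U = 0] is coprime to [l] only for [l = 1], where every residue is 0. *)
have [U0|U0] := posnP U.
  by move: hc c'l; rewrite U0 /coprime gcd0n => /eqP -> ; rewrite modn1; case: (c').
case: (egcdnP l U0) => km kn ek _; rewrite [(U * _)%N]mulnC ek.
move: hc; rewrite /coprime => /eqP ->.
by rewrite mulnDr muln1 mulnA modnMDl modn_small.
Qed.

(** * Walks around a reflexive polygon *)

Lemma no_injective_sequence (f : nat -> pt) (s : seq pt) : (forall i, f i \in s) -> ~ injective f.
Proof.
move=> fs fi; have u : uniq [seq f i | i <- iota 0 (size s).+1].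
  by rewrite map_inj_uniq ?iota_uniq.
have sub : {subset [seq f i | i <- iota 0 (size s).+1] <= s} by move=> _ /mapP[i _ ->].
by have := uniq_leq_size u sub; rewrite size_map size_iota ltnn.
Qed.

Lemma idet_eq0 (p q r : pt) : idet p q = 1 -> idet p r = 0 -> idet q r = 0 -> r = (0, 0).
Proof.
case: p q r => [a b] [c d] [u v]; rewrite /idet /= => h h1 h2; congr pair.
  transitivity (u * (a * d - b * c)); first by rewrite h mulr1.
  transitivity (a * (c * v - d * u) * -1 + c * (a * v - b * u)); first by ring.
  by rewrite h1 h2 !mulr0 mul0r.
transitivity (v * (a * d - b * c)); first by rewrite h mulr1.
transitivity (b * (c * v - d * u) * -1 + d * (a * v - b * u)); first by ring.
by rewrite h1 h2 !mulr0 mul0r.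
Qed.

Lemma opp_pt_neq0 (p : pt) : p != (0, 0) -> (- p.1, - p.2) != (0, 0).
Proof. by case: p => a b; rewrite !xpair_eqE !oppr_eq0. Qed.

Section Walk.
Variables (y : nat -> pt) (k : nat -> int).
Hypothesis y0 : y 0%N = (1, 0).
Hypothesis y1 : y 1%N = (0, 1).
Hypothesis yS : forall i, y i.+2 = next_point (k i) (y i.+1) (y i).
Hypothesis y_fin : forall N, ~ injective (fun i => y (N + i)%N).
Hypothesis y_le : forall m j, idot (nrm (y m) (y m.+1)) (y j) <= 1.

Lemma walk_det i : idet (y i) (y i.+1) = 1.
Proof.
elim: i => [|i IH]; first by rewrite y0 y1.
by rewrite -IH yS /idet /next_point /=; ring.
Qed.

Lemma walk_edge m p : idot (nrm (y m) (y m.+1)) p = idet (y m) p - idet (y m.+1) p.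
Proof. by rewrite /idot /nrm /idet /=; ring. Qed.

(* Along a walk the slope seen from the line through [p] is monotone, and on
   one side of that line the walk would therefore never return. *)
Lemma walk_turns p N : p != (0, 0) -> exists2 m, (N <= m)%N & idet (y m) p <= 0.
Proof.
move=> np; have [//|no] := pselect (exists2 m, (N <= m)%N & idet (y m) p <= 0).
have pos i : 0 < idet (y (N + i)%N) p.
  by rewrite ltNge; apply/negP => h; apply: no; exists (N + i)%N => //; apply: leq_addr.
pose q : pt := (- p.2, p.1).
have pq : 0 < idet p q.
  have -> : idet p q = p.1 * p.1 + p.2 * p.2 by rewrite /idet /=; ring.
  rewrite lt_def addr_ge0 -?expr2 ?sqr_ge0 // andbT paddr_eq0 ?sqr_ge0 // !sqrf_eq0.
  by apply: contra np => /andP[/eqP a /eqP b]; case: (p) a b => ? ? /= -> ->.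
pose r i : rat := (idet (y (N + i)%N) q)%:~R / (idet (y (N + i)%N) p)%:~R.
have rS i : r i < r i.+1.
  rewrite /r addnS ltr_pdivrMr ?ltr0z ?pos // mulrAC ltr_pdivlMr; last first.
    by rewrite ltr0z -addnS pos.
  rewrite -!intrM ltr_int -subr_gt0.
  have id (a b : pt) : idet b q * idet a p - idet a q * idet b p = idet a b * idet p q.
    by rewrite /idet /=; ring.
  by rewrite id walk_det mul1r.
have rlt : {homo r : i j / (i < j)%N >-> i < j} by apply: homo_ltn rS; apply: lt_trans.
case: (@y_fin N) => i j /= e; have er : r i = r j by rewrite /r e.
by case: (ltngtP i j) => // /rlt; rewrite er ltxx.
Qed.

(** Otherwise [idet (y m) p] never decreases along the walk, and [walk_turns] for [p] and for [-p]
    makes it vanish at two consecutive points, which form a basis. *)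
Lemma walk_cover p : p != (0, 0) -> exists m, 1 <= idot (nrm (y m) (y m.+1)) p.
Proof.
move=> np; have [//|no] := pselect (exists m, 1 <= idot (nrm (y m) (y m.+1)) p).
pose f m := idet (y m) p.
have fS m : f m <= f m.+1.
  rewrite leNgt; apply/negP => h; apply: no; exists m; rewrite walk_edge -/(f m) -/(f m.+1); lia.
have mono : {homo f : i j / (i <= j)%N >-> i <= j} by apply: homo_leq fS => //; apply: le_trans.
have le0 m : f m <= 0.
  by have [j mj fj] := walk_turns m np; apply: le_trans (mono _ _ mj) fj.
have np' := opp_pt_neq0 np.
have [m _ fm] := walk_turns 0 np'.
have fm' : f m >= 0 by move: fm; rewrite /f /idet /=; lia.
have a0 : f m = 0 by apply/eqP; rewrite eq_le le0.
have b0 : f m.+1 = 0 by apply/eqP; rewrite eq_le le0 (le_trans fm').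
by case/eqP: np; apply: idet_eq0 (walk_det m) a0 b0.
Qed.

Lemma walk_neq0 i : y i != (0, 0).
Proof. by apply/eqP => e; have := walk_det i; rewrite e /idet /= !mul0r. Qed.

Lemma walk_k_le i : k i <= 2.
Proof.
have := y_le i i.+2; rewrite walk_edge yS => h.
have e : idet (y i) (next_point (k i) (y i.+1) (y i)) = k i * idet (y i) (y i.+1).
  by rewrite /idet /next_point /=; ring.
have e' : idet (y i.+1) (next_point (k i) (y i.+1) (y i)) = idet (y i) (y i.+1).
  by rewrite /idet /next_point /=; ring.
by move: h; rewrite e e' walk_det; lia.
Qed.

(** An edge facing the opposite of [y i.+1] has value at most -1 at [y i.+1] and at most 1 at its
    two neighbours, whose sum is [k i] times [y i.+1]. *)
Lemma walk_k_ge i : -2 <= k i.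
Proof.
have [m hm] := walk_cover (opp_pt_neq0 (walk_neq0 i.+1)).
have h1 := y_le m i; have h2 := y_le m i.+2; rewrite yS in h2.
move: h1 h2 hm; move: (nrm _ _) => n.
rewrite /idot /next_point /=; move: (y i) (y i.+1) => [a b] [c d] /= h1 h2.
have -> : n.1 * - c + n.2 * - d = - (n.1 * c + n.2 * d) by ring.
have : k i * (n.1 * c + n.2 * d) <= 2.
  have -> : k i * (n.1 * c + n.2 * d) =
    (n.1 * (k i * c - a) + n.2 * (k i * d - b)) + (n.1 * a + n.2 * b) by ring.
  lia.
move: (n.1 * c + n.2 * d) (k i) => X K hX hK; nia.
Qed.

(* Five collinear steps at height one and a point below the origin level would
   force the lattice points [d] or [- d] of that level into the interior. *)
Lemma walk_straight i : ~~ ((y (i + 5)%N).1 - (y i).1 == 5%:Z * ((y (i + 5)%N).1 - (y (i + 4)%N).1))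
  || ~~ ((y (i + 5)%N).2 - (y i).2 == 5%:Z * ((y (i + 5)%N).2 - (y (i + 4)%N).2)).
Proof.
rewrite -negb_and; apply/negP => /andP[/eqP e1 /eqP e2].
set a := y (i + 4)%N in e1 e2; set z := y (i + 5)%N in e1 e2.
have daz : idet a z = 1 by rewrite /a /z (addnS i 4) walk_det.
pose d : pt := (z.1 - a.1, z.2 - a.2).
have dad : idet a d = 1 by rewrite -daz /idet /=; ring.
have nd : d != (0, 0) by apply/eqP => d0; move: dad; rewrite d0 /idet /= !mulr0.
have [j fj] : exists j, idet (y j) d < 0.
  have [//|no] := pselect (exists j, idet (y j) d < 0).
  have ge j : 0 <= idet (y j) d by rewrite leNgt; apply/negP => h; apply: no; exists j.
  (* The bound 1 guarantees a predecessor; at a zero of the level the recurrence makes the levels on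
     both sides opposite. *)
  have [[//|j] _ fj] := walk_turns 1 nd.
  have f0 : idet (y j.+1) d = 0 by apply/eqP; rewrite eq_le fj ge.
  have fS : idet (y j.+2) d = k j * idet (y j.+1) d - idet (y j) d.
    by rewrite yS /idet /next_point /=; ring.
  have g1 := ge j; have g2 := ge j.+2; rewrite fS f0 mulr0 in g2.
  have f1 : idet (y j) d = 0 by lia.
  by case/eqP: nd; apply: idet_eq0 (walk_det j) f1 f0.
set w := y j in fj; pose h : int := - idet w d; have h0 : 1 <= h by rewrite /h; lia.
pose X := idet w z; pose Z := idet a w.
have eh : h = - X - Z by rewrite /h /X /Z /idet /d /=; ring.
have c1 : w.1 = X * a.1 + Z * z.1.
  by transitivity (w.1 * idet a z); [rewrite daz mulr1|rewrite /X /Z /idet; ring].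
have c2 : w.2 = X * a.2 + Z * z.2.
  by transitivity (w.2 * idet a z); [rewrite daz mulr1|rewrite /X /Z /idet; ring].
(* With [d] as the direction of level zero, [w + h z] and [w + h (y i)] both lie on it: they are
   [- X] and [- X - 5 h] times [d]. *)
have up m : idot (nrm (y m) (y m.+1)) d * - X <= 1 + h.
  have h1 := y_le m j; have h2 := y_le m (i + 5); move: h1 h2; move: (nrm _ _) => n h1 h2.
  have -> : idot n d * - X = idot n w + h * idot n z.
    by rewrite eh {1}/idot [idot n w]/idot c1 c2 /idot /d /=; ring.
  by rewrite -/w in h1; rewrite -/z in h2; nia.
have dn m : idot (nrm (y m) (y m.+1)) d * (- X - 5%:Z * h) <= 1 + h.
  have h1 := y_le m j; have h2 := y_le m i; move: h1 h2; move: (nrm _ _) => n h1 h2.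
  have -> : idot n d * (- X - 5%:Z * h) = idot n w + h * idot n (y i).
    have -> : idot n (y i) = idot n z - 5%:Z * idot n d by rewrite /idot /d /=; move: e1 e2; lia.
    have -> : idot n w = X * idot n a + Z * idot n z by rewrite /idot c1 c2; ring.
    have -> : idot n a = idot n z - idot n d by rewrite /idot /d /=; ring.
    by rewrite eh; ring.
  by rewrite -/w in h1; nia.
have [m1 hm1] := walk_cover nd.
have [m2 hm2] := walk_cover (opp_pt_neq0 nd).
have hm2' : idot (nrm (y m2) (y m2.+1)) d <= -1.
  by move: hm2; rewrite /idot /=; lia.
have u1 := up m1; have u2 := dn m2.
move: hm1 hm2' u1 u2; move: (idot _ d) (idot _ d) => D1 D2 hm1 hm2' u1 u2.
(* The two bounds add up to [5 h <= 2 + 2 h], impossible for [h >= 1]. Four steps would allow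
   [h = 1], and such an edge occurs in [reps]. *)
have b1 : - X <= 1 + h by nia.
have b2 : 5%:Z * h + X <= 1 + h by nia.
lia.
Qed.
End Walk.

Section WalkSearch.
Variables (y : nat -> pt) (k : nat -> int).
Hypothesis y0 : y 0%N = (1, 0).
Hypothesis y1 : y 1%N = (0, 1).
Hypothesis yS : forall i, y i.+2 = next_point (k i) (y i.+1) (y i).
Hypothesis y_fin : forall N, ~ injective (fun i => y (N + i)%N).
Hypothesis y_le : forall m j, idot (nrm (y m) (y m.+1)) (y j) <= 1.

Fixpoint walk_rev (n : nat) : seq pt := if n is m.+1 then y m :: walk_rev m else [::].

Lemma rev_walk_rev n : rev (walk_rev n) = [seq y i | i <- iota 0 n].
Proof. by elim: n => // n IH; rewrite -[n.+1]addn1 iotaD map_cat -IH addn1 /= rev_cons -cats1. Qed.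

Lemma walk_rev_mem n p : p \in walk_rev n -> exists i, p = y i.
Proof. by elim: n => // n IH; rewrite inE => /orP[/eqP->|//]; exists n. Qed.

Lemma walk_prefix_ok n : prefix_ok (walk_rev n).
Proof.
apply/andP; split.
  move: n => [|[|[|[|[|[|n]]]]]] //=; rewrite negb_and.
  by have := walk_straight y0 y1 yS y_fin y_le n; rewrite !addnS !addn0.
have h m e : e \in zip (walk_rev m) (behead (walk_rev m)) -> exists i, e = (y i.+1, y i).
  elim: m => [|[|m] IH] //=; rewrite inE => /orP[/eqP->|]; first by exists m.
  exact: IH.
apply/allP => e /h [i ->]; apply/allP => p /walk_rev_mem [j ->]; exact: y_le.
Qed.

(** The search always has the walk among its branches: its multiplier is one of the five tried, and
    its prefixes pass the tests. *)
Lemma walk_search fuel m :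
  [::] \in search fuel (y m.+1) (y m) (walk_rev m) \/
  exists n, [/\ y n = (1, 0), (2 <= n)%N &
    [seq y i | i <- iota 0 n] \in search fuel (y m.+1) (y m) (walk_rev m)].
Proof.
elim: fuel m => [|fuel IH] m; first by left; rewrite mem_head.
have kin : k m \in [:: -2; -1; 0; 1; 2].
  have := walk_k_le y0 y1 yS y_le m; have := walk_k_ge y0 y1 yS y_fin y_le m.
  by rewrite !inE; move: (k m) => c; lia.
pose F c := let z := next_point c (y m.+1) (y m) in
      if prefix_ok [:: z, y m.+1, y m & walk_rev m] then
        if z == (1, 0) then [:: rev [:: y m.+1, y m & walk_rev m]] else
          search fuel z (y m.+1) (y m :: walk_rev m)
      else [::].
have sub x : x \in F (k m) -> x \in search fuel.+1 (y m.+1) (y m) (walk_rev m).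
  by move=> xF; apply/flattenP; exists (F (k m)) => //; apply: (map_f F).
move: sub; rewrite /F -yS -[[:: y m.+2, _, _ & _]]/(walk_rev m.+3) walk_prefix_ok.
rewrite -[[:: y m.+1, _ & _]]/(walk_rev m.+2) rev_walk_rev.
case: eqP => [e|_] sub.
  by right; exists m.+2; split => //; apply: sub; rewrite mem_head.
case: (IH m.+1) => [h|[n [h1 h2 h3]]]; first by left; apply: sub.
by right; exists n; split => //; apply: sub.
Qed.

Lemma walk_loop : exists n, [/\ y n = (1, 0), (2 <= n)%N &
  [seq y i | i <- iota 0 n] \in search 12 (0, 1) (1, 0) [::]].
Proof.
have := walk_search 12 0; rewrite y0 y1 => -[h|//].
by have := allP search_loops _ h.
Qed.

Lemma walk_next n i : y n = (1, 0) -> (i < n)%N -> uniq [seq y i | i <- iota 0 n] ->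
  next [seq y i | i <- iota 0 n] (y i) = y i.+1.
Proof.
move=> en il u; rewrite next_nth map_f; last by rewrite mem_iota add0n.
have -> : index (y i) [seq y i | i <- iota 0 n] = i.
  have e : y i = nth (0, 0) [seq y i | i <- iota 0 n] i.
    by rewrite (nth_map 0%N) ?size_iota // nth_iota.
  by rewrite e index_uniq ?size_map ?size_iota.
case: n il en u => // n il en _ /=.
case: (ltngtP i n) => h; last 1 first.
(* After the last point [next] takes its default, the head of the list, which is [y n] since the
   walk has returned. *)
- by rewrite h nth_default ?size_map ?size_iota // en y0.
- by rewrite (nth_map 0%N) ?size_iota // nth_iota.
- by lia.
Qed.

End WalkSearch.

Lemma seq_argmax (T : eqType) (s : seq T) (f : T -> rat) : s != [::] ->
  exists2 x, x \in s & forall z, z \in s -> f z <= f x.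
Proof.
elim: s => // a s IH _; have [->|/IH [x xs hx]] := eqVneq s [::].
  by exists a; rewrite ?mem_head // => z; rewrite inE => /eqP ->.
have [h|h] := lerP (f a) (f x).
  by exists x; rewrite ?inE ?xs ?orbT // => z; rewrite inE => /orP[/eqP->|/hx].
exists a; rewrite ?mem_head // => z; rewrite inE => /orP[/eqP->//|/hx /le_trans]; apply.
exact: ltW.
Qed.

Lemma mean_max (t a b c : rat) : 0 < t -> t < 1 -> a <= c -> b <= c ->
  (1 - t) * a + t * b = c -> a = c /\ b = c.
Proof. by move=> t0 t1 ac bc e; split; apply/eqP; rewrite eq_le ?ac ?bc /=; nra. Qed.

(** * Boundary lattice points of a reflexive polygon *)

Section LatticeSteps.
Variables (P : set vec2) (l : nat).
Hypotheses (l0 : (0 < l)%N) (rP : reflexive_polygon l P).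

Let lr0 : 0 < l%:R :> rat. Proof. by rewrite ltr0n. Qed.

Lemma reflexive_hull : exists s : seq pt, (forall z, P z <-> polyhull s z) /\
  forall v, v \in s -> extreme P (emb v).
Proof.
case: rP => -[[k [A eP]] _ hv] _ _ _.
have [s [hs e]] := hull_extreme [seq row i A | i <- enum 'I_k].
have PE z : P z <-> hull [seq row i A | i <- enum 'I_k] z by rewrite eP conv_rows_hull.
have ext v : v \in s -> extreme P v.
  move=> /hs [h1 h2]; split; first exact/PE.
  by move=> x y t /PE hx /PE hy; apply: h2.
have [s' es] : exists s' : seq pt, s = map emb s'.
  elim: s ext {hs e} => [|v s IH] ext; first by exists [::].
  have [|s' ->] := IH; first by move=> w ws; apply: ext; rewrite inE ws orbT.
  have [z ez] := hv v (ext v (mem_head _ _)).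
  by exists ((z 0 0, z 0 1) :: s'); rewrite /= -latE -ez.
exists s'; split=> [z|v vs]; first by rewrite PE e es.
by apply: ext; rewrite es map_f.
Qed.

Lemma reflexive_convex : convex_pred P.
Proof.
have [s [hP _]] := reflexive_hull.
by move=> x z t /hP hx /hP hz ht; apply/hP; apply: hull_convex.
Qed.

Lemma reflexive0 : P 0.
Proof. by case: rP => _ [e e0 h] _ _; apply: h => i; rewrite mxE normr0. Qed.

Lemma extreme_cop v : extreme P (emb v) -> cop v.
Proof.
move=> ev; apply/primitiveE; case: rP => _ _ prim _; apply: prim.
by rewrite lat_zvec; exact: ev.
Qed.

Definition boundary_point (x : pt) := P (emb x) /\ forall t : rat, 1 < t -> ~ P (t *: emb x).

(** Coprimality of the normal says that no lattice point lies strictly between [x] and [y]. *)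
Definition lattice_step (x y : pt) := [/\ boundary_point y, idet x y = l,
  cop (nrm x y) & forall z, P z -> dot (emb (nrm x y)) z <= l%:R].

Lemma exists_dot_pos u : u != 0 -> exists2 z, P z & 0 < dot u z.
Proof.
move=> nu; case: rP => _ [e e0 h] _ _.
have n0 : 0 < `|cx u| + `|cy u|.
  rewrite lt_def addr_ge0 ?normr_ge0 // andbT paddr_eq0 ?normr_ge0 // !normr_eq0.
  by apply: contra nu => /andP[/eqP a /eqP b]; apply/eqP/vec2P; rewrite ?cE.
pose t := e / (`|cx u| + `|cy u|) / 2%:R.
have t0 : 0 < t by rewrite !divr_gt0.
have et : t * (`|cx u| + `|cy u|) * 2%:R = e by rewrite /t; field; rewrite gt_eqF.
exists (t *: u); last first.
  rewrite dotZ; apply: mulr_gt0 => //; rewrite /dot -!expr2.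
  rewrite lt_def addr_ge0 ?sqr_ge0 // andbT paddr_eq0 ?sqr_ge0 // !sqrf_eq0.
  by apply: contra nu => /andP[/eqP a /eqP b]; apply/eqP/vec2P; rewrite ?cE.
have hx : `|t * cx u| < e.
  by rewrite normrM (gtr0_norm t0) -et; have := normr_ge0 (cx u); have := normr_ge0 (cy u); nra.
have hy : `|t * cy u| < e.
  by rewrite normrM (gtr0_norm t0) -et; have := normr_ge0 (cx u); have := normr_ge0 (cy u); nra.
apply: h => -[[|[|//]] hi].
  by have -> : Ordinal hi = 0 by [apply/val_inj]; rewrite mxE.
by have -> : Ordinal hi = 1 by [apply/val_inj]; rewrite mxE.
Qed.

Lemma boundary_neq0 x : boundary_point x -> emb x != 0.
Proof.
case=> Px h; apply/eqP => e; apply: (h 2%:R) => //.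
by rewrite e scaler0; exact: reflexive0.
Qed.

(* Gift wrapping: among the vertices to the left of the line from the origin
   through [x], take the one that is seen from [x] at the extreme angle. *)
Lemma supporting_vertex x : boundary_point x -> exists w : pt, [/\ extreme P (emb w),
  0 < idet x w & forall z, P z -> dot (emb (nrm x w)) z <= (idet x w)%:~R].
Proof.
move=> bx; have nx := boundary_neq0 bx; have [s [hP hs]] := reflexive_hull.
pose D v := det (emb x) (emb v).
pose S := [seq v <- s | 0 < D v].
have nS : S != [::].
  apply/eqP => S0; pose u := vec (- cy (emb x)) (cx (emb x)).
  have du z : dot u z = det (emb x) z by rewrite /dot /det !cE; ring.
  have nu : u != 0.
    apply: contra nx => /eqP e; have := congr1 cx e; have := congr1 cy e; rewrite !cE => a b.
    by apply/eqP/vec2P; rewrite !ceE //; lra.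
  have [z Pz hz] := exists_dot_pos nu.
  have : dot u z <= 0.
    apply: (@hull_le (map emb s)); last exact/hP.
    move=> _ /mapP[v vs ->]; rewrite du leNgt; apply/negP => h.
    by have : v \in S; [rewrite mem_filter /D h|rewrite S0].
  by rewrite leNgt hz.
(* The score is the cotangent of the angle from the direction of [x] to [v - x], so its maximum is
   the outermost vertex. *)
have [w] := @seq_argmax _ S (fun v => dot (emb x) (emb v - emb x) / D v) nS.
rewrite mem_filter => /andP[Dw ws] hw; exists w; split; first exact: hs.
  by move: Dw; rewrite /D det_emb ltr0z.
have nw z : (idet x w)%:~R - dot (emb (nrm x w)) z = det (emb w - emb x) (z - emb x).
  by rewrite -det_emb /dot /det !ceE /= !rmorphB /=; ring.
move=> z /hP; apply: (@hull_le (map emb s)) => _ /mapP[v vs ->].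
rewrite -subr_ge0 nw.
have xx : 0 < dot (emb x) (emb x).
  rewrite /dot -!expr2 lt_def addr_ge0 ?sqr_ge0 // andbT paddr_eq0 ?sqr_ge0 // !sqrf_eq0.
  by apply: contra nx => /andP[/eqP a /eqP b]; apply/eqP/vec2P; rewrite cE.
have [Dv|Dv] := ltrP 0 (D v).
  have vS : v \in S by rewrite mem_filter Dv.
  have := hw _ vS; rewrite ler_pdivrMr // mulrAC ler_pdivlMr // -subr_ge0.
  have -> : dot (emb x) (emb w - emb x) * D v - dot (emb x) (emb v - emb x) * D w =
    dot (emb x) (emb x) * det (emb w - emb x) (emb v - emb x).
    by rewrite /D /dot /det !cE; ring.
  by rewrite pmulr_rge0.
(* If [v] lay beyond the line through [x] and [w], the segment from [v] to [w] would cross the ray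
   through [x] beyond [x]. *)
rewrite leNgt; apply/negP => g0; case: bx => Px; set g := det _ _ in g0.
have DD : 0 < D w - D v by lra.
move/(_ (1 - g / (D w - D v))); case.
  by rewrite ltrDl -mulNr divr_gt0 // oppr_gt0.
have -> : (1 - g / (D w - D v)) *: emb x =
    (1 - - D v / (D w - D v)) *: emb v + (- D v / (D w - D v)) *: emb w.
  apply: vec2P; rewrite !cE /g; have n0 : D w - D v != 0 by rewrite gt_eqF.
    by move: n0; rewrite /D /det !cE => n0; field.
  by move: n0; rewrite /D /det !cE => n0; field.
apply: reflexive_convex; [by case: (hs _ vs)|by case: (hs _ ws)|].
by rewrite divr_ge0 ?ler_pdivrMr ?oppr_ge0 ?(ltW DD) //= mul1r; lra.
Qed.

Lemma lattice_step_exists x : boundary_point x -> exists y, lattice_step x y.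
Proof.
move=> bx; have [w [[Pw ew] c0 hw]] := supporting_vertex bx; case: (bx) => Px _.
set c := idet x w in c0 hw; set n := emb (nrm x w) in hw.
have cr0 : 0 < c%:~R :> rat by rewrite ltr0z.
have nx : dot n (emb x) = c%:~R by rewrite dot_emb /c /idot /idet /nrm /=; congr intr; ring.
have nw : dot n (emb w) = c%:~R by rewrite dot_emb /c /idot /idet /nrm /=; congr intr; ring.
have dxw : det (emb x) (emb w) != 0 by rewrite det_emb intr_eq0 gt_eqF.
have n0 : n != 0.
  by apply/eqP => e; move: nx; rewrite e /dot !cE !mul0r addr0 => /esym/eqP; rewrite gt_eqF.
have ne : emb x != emb w.
  by apply/eqP => e; move: dxw; rewrite e /det [X in X - _]mulrC subrr eqxx.
case: rP => _ _ _ fac.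
have [_ [u [pu eF]]] := fac _ (facet_two n0 hw Px Pw ne nx nw).
pose p : pt := (u 0 0, u 0 1).
have cp : cop p by apply/primitiveE; rewrite /p -zvecE.
have on_F z : P z -> dot n z = c%:~R -> dot (emb p) z = l%:R.
  move=> Pz ez; have : [set z | P z /\ pairing n z = c%:~R] z by split; rewrite // pairingE.
  by rewrite eF => -[_]; rewrite pairingE latE.
have px := on_F _ Px nx; have pw := on_F _ Pw nw.
have dZ a (v z : vec2) : dot (a *: v) z = a * dot v z by rewrite /dot !cE; ring.
have enp : l%:R *: n = c%:~R *: emb p.
  by apply: (dot_inj dxw); rewrite !dZ ?nx ?nw ?px ?pw mulrC.
have ple z : P z -> dot (emb p) z <= l%:R.
  by move=> /hw h; rewrite -(ler_pM2l cr0) -dZ -enp dZ mulrC ler_pM2r.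
(* [x] plus the primitive normal turned by a right angle: the next lattice point on the facet line,
   in the direction of [w]. *)
pose y : pt := (x.1 - p.2, x.2 + p.1).
have nxy : nrm x y = p by rewrite /nrm /y /p /=; congr pair; ring.
have ipx : idot p x = l by apply: (@intr_inj rat); rewrite -dot_emb px.
have ipw : idot p w = l by apply: (@intr_inj rat); rewrite -dot_emb pw.
have ixy : idet x y = l by rewrite -ipx /idet /idot /y /=; ring.
have py : dot (emb p) (emb y) = l%:R.
  by rewrite dot_emb -[RHS]/((l%:Z)%:~R) -ipx; congr intr; rewrite /idot /y /=; ring.
have [t [t1 e1 e2]] : exists t : int, [/\ 0 < t, w.1 = x.1 - t * p.2 & w.2 = x.2 + t * p.1].
  have /copP [a [b ab]] := cp.
  pose t := a * (w.2 - x.2) - b * (w.1 - x.1).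
  have o : p.1 * (w.1 - x.1) + p.2 * (w.2 - x.2) = 0.
    transitivity (idot p w - idot p x); first by rewrite /idot; ring.
    by rewrite ipw ipx subrr.
  have e1 : w.1 = x.1 - t * p.2.
    transitivity (x.1 + (w.1 - x.1) * (a * p.1 + b * p.2)); first by rewrite ab; ring.
    transitivity (x.1 - t * p.2 + a * (p.1 * (w.1 - x.1) + p.2 * (w.2 - x.2))); first by rewrite /t; ring.
    by rewrite o mulr0 addr0.
  have e2 : w.2 = x.2 + t * p.1.
    transitivity (x.2 + (w.2 - x.2) * (a * p.1 + b * p.2)); first by rewrite ab; ring.
    transitivity (x.2 + t * p.1 + b * (p.1 * (w.1 - x.1) + p.2 * (w.2 - x.2))); first by rewrite /t; ring.
    by rewrite o mulr0 addr0.
  exists t; split => //.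
  have : c = t * l by rewrite -ipx /c /idet e1 e2 /idot; ring.
  by move: c0; nia.
have tr : 1 <= t%:~R :> rat by rewrite ler1z; lia.
exists y; split => //; rewrite ?nxy //; split.
  have -> : emb y = (1 - t%:~R^-1) *: emb x + t%:~R^-1 *: emb w.
    have tn : t%:~R != 0 :> rat by rewrite gt_eqF // (lt_le_trans _ tr).
    by apply: vec2P; rewrite !ceE ?e1 ?e2 /= ?(rmorphB, rmorphD, rmorphM) /=; field.
  by apply: reflexive_convex => //; rewrite invr_ge0 invf_le1 ?tr ?(le_trans _ tr) ?(lt_le_trans _ tr).
by move=> r r1 /ple; rewrite dotZ py leNgt ltr_pMl ?r1.
Qed.

(** Equal determinants make [x + z] parallel to [y]. At a bend [y] is a vertex, hence primitive, and
    the factor is an integer; on a straight stretch [y] may fail to be primitive, but there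
    [x + z = 2 y]. *)
Lemma step_kappa x y z : boundary_point x -> lattice_step x y -> lattice_step y z ->
  exists k, z = next_point k y x.
Proof.
move=> [Px _] [[Py _] dxy _ lxy] [_ dyz _ lyz].
have [e|ne] := eqVneq (nrm x y) (nrm y z).
  exists 2; move: e; rewrite /nrm /next_point => -[e1 e2].
  by case: (z) e1 e2 => a b /= e1 e2; congr pair; lia.
have /copP [u [v uv]] : cop y.
  apply: extreme_cop; split => // a b t Pa Pb /andP[t0 t1] ey; apply/eqP/negPn/negP => nab.
  case/eqP: ne; apply: emb_inj.
  have xy : dot (emb (nrm x y)) (emb y) = l%:R.
    by rewrite dot_emb -[RHS]/((l%:Z)%:~R) -dxy; congr intr; rewrite /idot /nrm /idet /=; ring.
  have yz : dot (emb (nrm y z)) (emb y) = l%:R.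
    by rewrite dot_emb -[RHS]/((l%:Z)%:~R) -dyz; congr intr; rewrite /idot /nrm /idet /=; ring.
  have a1 := lxy _ Pa; have b1 := lxy _ Pb; have a2 := lyz _ Pa; have b2 := lyz _ Pb.
  move: xy yz; rewrite ey !dot_comb => xy yz.
  have [ea1 eb1] := mean_max t0 t1 a1 b1 xy.
  have [ea2 eb2] := mean_max t0 t1 a2 b2 yz.
  have d : det a b != 0 by apply: (@dot_det0 (emb (nrm x y))); rewrite ?ea1 ?eb1 // gt_eqF.
  exact: (dot_inj d (etrans ea1 (esym ea2)) (etrans eb1 (esym eb2))).
have o : y.1 * (x.2 + z.2) = y.2 * (x.1 + z.1).
  apply/eqP; rewrite -subr_eq0; have -> : y.1 * (x.2 + z.2) - y.2 * (x.1 + z.1) = idet y z - idet x y.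
    by rewrite /idet; ring.
  by rewrite dxy dyz subrr.
exists (u * (x.1 + z.1) + v * (x.2 + z.2)); rewrite /next_point [LHS]surjective_pairing; congr pair.
  transitivity ((x.1 + z.1) * (u * y.1 + v * y.2) - x.1); first by rewrite uv; ring.
  transitivity (u * (x.1 + z.1) * y.1 + v * (y.2 * (x.1 + z.1)) - x.1); first by ring.
  by rewrite -o; ring.
transitivity ((x.2 + z.2) * (u * y.1 + v * y.2) - x.2); first by rewrite uv; ring.
transitivity (u * (y.1 * (x.2 + z.2)) + v * (x.2 + z.2) * y.2 - x.2); first by ring.
by rewrite o; ring.
Qed.

Lemma boundary_point_exists : exists x, boundary_point x.
Proof.
have [s [hP hs]] := reflexive_hull; case: s hP hs => [|v s] hP hs.
  by have /hP/hull_nil := reflexive0.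
have ev := hs v (mem_head _ _); exists v; case: (ev) => Pv ext; split => // t t1 Pt.
have t0 : 0 < t by lra.
have e : emb v = (1 - t^-1) *: 0 + t^-1 *: (t *: emb v).
  by rewrite scaler0 add0r scalerA mulVf ?scale1r // gt_eqF.
have h : 0 < t^-1 < 1 by rewrite invr_gt0 t0 invf_lt1.
have /esym/eqP := ext _ _ _ reflexive0 Pt h e; rewrite scaler_eq0 gt_eqF //= -emb0.
rewrite (inj_eq emb_inj) => /eqP v0; have := extreme_cop ev.
by rewrite v0 => /copP [a [b /=]]; lia.
Qed.

Lemma lattice_points_finite : exists s : seq pt, forall x, P (emb x) -> x \in s.
Proof.
have [s [hP _]] := reflexive_hull.
pose K := (\max_(v <- s) (`|v.1| + `|v.2|))%N.
have hK (v : pt) : v \in s -> [/\ v.1 <= K, - v.1 <= K, v.2 <= K & - v.2 <= K].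
  move=> vs; have : (`|v.1| + `|v.2| <= K)%N by rewrite /K (big_rem v) //= leq_maxl.
  by move: K => K; split; lia.
pose r : seq int := [seq i%:Z - K%:Z | i <- iota 0 (K + K).+1].
exists [seq (a, b) | a <- r, b <- r] => x /hP hx.
have mem_r (a : int) : (`|a| <= K)%N -> a \in r.
  move=> ha; apply/mapP; exists `|(a + K%:Z)%R|%N; last by lia.
  by rewrite mem_iota; lia.
have hdot (u : pt) : (forall v, v \in s -> idot u v <= K) -> idot u x <= K.
  move=> h; rewrite -(ler_int rat) -dot_emb; apply: (@hull_le (map emb s)) hx.
  by move=> _ /mapP[v vs ->]; rewrite dot_emb ler_int h.
have b1 : idot (1, 0) x <= K.
  by apply: hdot => v /hK []; rewrite /idot /= ?mul1r ?mulN1r ?mul0r ?addr0 ?add0r.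
have b2 : idot (-1, 0) x <= K.
  by apply: hdot => v /hK []; rewrite /idot /= ?mul1r ?mulN1r ?mul0r ?addr0 ?add0r.
have b3 : idot (0, 1) x <= K.
  by apply: hdot => v /hK []; rewrite /idot /= ?mul1r ?mulN1r ?mul0r ?addr0 ?add0r.
have b4 : idot (0, -1) x <= K.
  by apply: hdot => v /hK []; rewrite /idot /= ?mul1r ?mulN1r ?mul0r ?addr0 ?add0r.
rewrite /idot /= in b1 b2 b3 b4.
by apply/allpairsPdep; exists x.1, x.2; split; [apply: mem_r; lia|apply: mem_r; lia|case: (x)].
Qed.

End LatticeSteps.

Lemma reflexive_loop l P : (0 < l)%N -> reflexive_polygon l P -> exists Q W,
  [/\ Q \in search 12 (0, 1) (1, 0) [::], `|mdet W|%N = l & P = polygon Q W].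
Proof.
move=> l0 rP; have [x0 bx0] := boundary_point_exists l0 rP.
have [f hf] : exists f : pt -> pt, forall x, boundary_point P x -> lattice_step P l x (f x).
  have ex x : exists y, boundary_point P x -> lattice_step P l x y.
    have [/(lattice_step_exists l0 rP) [y hy]|no] := pselect (boundary_point P x).
      by exists y.
    by exists x => /no.
  by have [f hf] := choice ex; exists f.
pose x i := iter i f x0.
have bx i : boundary_point P (x i).
  by elim: i => // i /hf []; rewrite -/(x i) -[f _]/(x i.+1).
have st i : lattice_step P l (x i) (x i.+1) by exact: (hf _ (bx i)).
have [k hk] : exists k : nat -> int, forall i, x i.+2 = next_point (k i) (x i.+1) (x i).
  by have [k hk] := choice (fun i => step_kappa l0 rP (bx i) (st i) (st i.+1)); exists k.
(* The same recurrence in the basis [x 0], [x 1]; it has order two, hence the pairs. *)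
pose yy := fix yy i : pt * pt := if i is j.+1
  then ((yy j).2, next_point (k j) (yy j).2 (yy j).1) else ((1, 0), (0, 1)).
pose y i := (yy i).1.
have yS i : y i.+2 = next_point (k i) (y i.+1) (y i) by [].
pose W := (x 0%N, x 1%N).
have dW : mdet W = l by case: (st 0%N).
have xy i : x i = mul (y i) W /\ x i.+1 = mul (y i.+1) W.
  elim: i => [|i [h1 h2]].
    by split; rewrite /mul /= ?mul1r ?mul0r ?addr0 ?add0r -surjective_pairing.
  by split=> //; rewrite hk h1 h2 yS /mul /next_point /=; congr pair; ring.
have {}xy i : x i = mul (y i) W by case: (xy i).
have lz : l%:Z != 0 by lia.
have nrmE a b : onrm W (nrm a b) = nrm (mul a W) (mul b W).
  rewrite /onrm dW; have -> : sgz l%:Z = 1 by apply/eqP; rewrite sgz_cp0; lia.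
  by rewrite /nrm /mul /=; congr pair; ring.
have y_le m j : idot (nrm (y m) (y m.+1)) (y j) <= 1.
  have [_ _ _ h] := st m; have [Pj _] := bx j; have := h _ Pj.
  rewrite !xy -nrmE emb_mul dot_onrm dW dot_emb absz_nat.
  by rewrite -[X in _ <= X -> _]mulr1 ler_pM2l ?ltr0n // lerz1.
have y_fin N : ~ injective (fun i => y (N + i)%N).
  move=> yi; have [s hs] := lattice_points_finite l0 rP.
  apply: (@no_injective_sequence (fun i => x (N + i)%N) s).
    by move=> i; apply: hs; case: (bx (N + i)%N).
  move=> i j /=; rewrite !xy => e; apply: yi; apply: mul_inj e.
  by rewrite dW.
have [n [yn n2 QS]] := walk_loop (erefl : y 0%N = (1, 0)) (erefl : y 1%N = (0, 1)) yS y_fin y_le.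
set Q := map _ _ in QS; exists Q, W.
have gQ : goodloop Q by have /andP[] := allP search_loops _ QS.
split; rewrite ?dW //; apply/funext => z; apply/propext.
have dW' : `|mdet W|%N = l by rewrite dW.
split=> [Pz|].
  apply/(polygonP gQ l0 dW') => q qQ; have /mapP[i] := qQ; rewrite mem_iota add0n => /= il eq.
  rewrite /edge eq (walk_next erefl yn il (good_uniq gQ)) nrmE -!xy.
  by have [_ _ _] := st i; apply.
case=> v hv <-; move: hv; apply: (@polyhull_sub _ (fun v => P (ap W v))).
  by move=> a b t ha hb ht; rewrite ap_comb; apply: (reflexive_convex rP).
by move=> _ /mapP[i _ ->]; rewrite -emb_mul -xy; case: (bx i).
Qed.

(** * Counting *)

(** Normals transform by the inverse transpose of [A], which is the [B] given here. *)
Lemma onrm_mulM W A n : `|mdet A|%N = 1%N -> exists2 B, `|mdet B|%N = 1%N &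
  onrm (mulM W A) n = mul (onrm W n) B.
Proof.
move=> dA; pose s := sgz (mdet A).
have s1 : `|s|%N = 1%N by rewrite /s; case/absz1: dA => ->.
exists ((s * A.2.2, - (s * A.2.1)), (- (s * A.1.2), s * A.1.1)).
  rewrite -dA /mdet /idet /=.
  have -> : s * A.2.2 * (s * A.1.1) - - (s * A.2.1) * - (s * A.1.2) =
    s * s * (A.1.1 * A.2.2 - A.1.2 * A.2.1) by ring.
  by rewrite !abszM s1 !mul1n.
rewrite /onrm mdetM sgzM -/s /mul /=; congr pair; ring.
Qed.

Lemma valid_mulM Q W A : `|mdet A|%N = 1%N -> valid Q W -> valid Q (mulM W A).
Proof.
move=> dA /allP h; apply/allP => x xQ; have /andP[/implyP h1 h2] := h x xQ.
apply/andP; split.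
  by apply/implyP => /h1; rewrite mul_mulM; apply: cop_mul.
by have [B dB ->] := onrm_mulM W (edge Q x) dA; apply: cop_mul.
Qed.

Lemma isomorphic_polygon_refl Q W : isomorphic (polygon Q W) (polygon Q W).
Proof.
pose I : pt * pt := ((1, 0), (0, 1)).
have d1 : `|mdet I|%N = 1%N by [].
exact: isomorphic_trans (isomorphic_polygon Q W d1) (isomorphic_sym (isomorphic_polygon Q W d1)).
Qed.

Lemma mem_codes l Q c : (Q, c) \in codes l <->
  [/\ Q \in reps, (c < l)%N & min_code l Q (maps Q Q) c].
Proof.
split.
  case/allpairsPdep => Q' [c' [QR]]; rewrite mem_filter mem_iota add0n leq0n => /andP[m cl] [-> ->].
  by split.
case=> QR cl m; apply/allpairsPdep; exists Q, c; split=> //.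
by rewrite mem_filter m mem_iota add0n leq0n.
Qed.

Lemma codes_uniq l : uniq (codes l).
Proof.
apply: allpairs_uniq_dep => // [Q _|[Q c] [Q' c'] _ _ /= [-> ->] //].
by apply: filter_uniq; apply: iota_uniq.
Qed.

Section Codes.
Variable l : nat.
Hypothesis l0 : (0 < l)%N.

Lemma mdet_hnf c : `|mdet (hnf l c)|%N = l.
Proof. by have -> : mdet (hnf l c) = l by [rewrite /mdet /idet /hnf /=; ring]. Qed.

Lemma rebase Q Q0 S W : goodloop Q -> goodloop Q0 -> size Q0 = size Q -> S \in maps Q Q0 ->
  `|mdet W|%N = l -> valid Q W ->
  exists A c, [/\ `|mdet A|%N = 1%N, (c < l)%N, mulM (mulM S W) A = hnf l c,
    valid Q0 (hnf l c) & isomorphic (polygon Q W) (polygon Q0 (hnf l c))].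
Proof.
move=> gQ gQ0 sz mS dW vW; have e := polygon_rebase W gQ gQ0 sz mS.
have [S1 S2 vS dS _] := (mapsP _ _ _).1 mS.
have dSW : `|mdet (mulM S W)|%N = l by rewrite mdetM abszM dS dW mul1n.
have vSW : valid Q0 (mulM S W).
  apply/(reflexive_polygonP gQ0 l0 dSW); rewrite -e; exact/(reflexive_polygonP gQ l0 dW).
(* The first row is the image of the vertex [S.1], hence primitive. *)
have c1 : cop (mulM S W).1 by have /allP/(_ _ S1)/andP[/implyP/(_ vS)] := vW.
have [A [c [dA cl eA]]] := normal_form l0 dSW c1.
exists A, c; split => //; rewrite -eA; first exact: valid_mulM.
by rewrite e; apply: isomorphic_polygon.
Qed.

Lemma reps_goodloop Q : Q \in reps -> goodloop Q.
Proof. by move/(allP reps_good) => /and3P[]. Qed.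

(** Descent: an automorphism with a smaller value of [mob] exhibits an isomorphic image with that
    smaller parameter. *)
Lemma min_code_exists Q c : Q \in reps -> (c < l)%N -> valid Q (hnf l c) ->
  exists2 c', (Q, c') \in codes l & isomorphic (polygon Q (hnf l c)) (polygon Q (hnf l c')).
Proof.
move=> QR; have gQ := reps_goodloop QR.
have [n le_n] := ubnP c; elim: n => // n IH in c le_n * => cl vc.
have [m|] := boolP (all (fun S => c <= mob l S c)%N (maps Q Q)).
  exists c; first by apply/mem_codes; split => //; rewrite /min_code vc m.
  exact: isomorphic_polygon_refl.
case/allPn => S mS; rewrite -ltnNge => lt_c.
have [A [c1 [dA c1l eA v1 i1]]] := rebase gQ gQ erefl mS (mdet_hnf c) vc.
have e1 := mobP l0 c1l dA eA.
have [|c' c'C i2] := IH c1 _ c1l v1; first by rewrite e1; lia.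
by exists c' => //; apply: isomorphic_trans i1 i2.
Qed.

Lemma code_exists Q W : Q \in search 12 (0, 1) (1, 0) [::] -> `|mdet W|%N = l -> valid Q W ->
  exists2 p, p \in codes l & isomorphic (polygon Q W) (polygon p.1 (hnf l p.2)).
Proof.
move/(allP search_loops) => /andP[gQ /hasP[Q0 QR /andP[/eqP sz nm]]] dW vW.
have [S mS] : exists S, S \in maps Q Q0.
  by move: nm; case: (maps Q Q0) => // S s _; exists S; rewrite mem_head.
have gQ0 := reps_goodloop QR.
have [A [c [dA cl eA vc i1]]] := rebase gQ gQ0 sz mS dW vW.
have [c' c'C i2] := min_code_exists QR cl vc.
by exists (Q0, c') => //; apply: isomorphic_trans i1 i2.
Qed.

Lemma code_le Q Q' c c' : (Q, c) \in codes l -> (Q', c') \in codes l ->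
  isomorphic (polygon Q (hnf l c)) (polygon Q' (hnf l c')) ->
  maps Q Q' != [::] /\ (Q = Q' -> (c <= c')%N).
Proof.
move=> /mem_codes [QR cl /andP[vc mc]] /mem_codes [QR' cl' /andP[vc' _]] i.
have /and3P[gQ' /eqP n10 v10] := allP reps_good _ QR'.
have [S [A [mS dA eA]]] := isomorphic_maps (reps_goodloop QR) gQ' l0 (mdet_hnf c) (mdet_hnf c')
  vc vc' n10 v10 i.
split; first by apply: contraTneq mS => ->.
move=> eQ; rewrite -eQ in mS; rewrite mulM_A in eA.
by rewrite (mobP l0 cl' dA eA); apply: (allP mc).
Qed.

Lemma code_inj p q : p \in codes l -> q \in codes l ->
  isomorphic (polygon p.1 (hnf l p.2)) (polygon q.1 (hnf l q.2)) -> p = q.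
Proof.
case: p q => [Q c] [Q' c'] pC qC /= i.
have [n1 h1] := code_le pC qC i; have [n2 h2] := code_le qC pC (isomorphic_sym i).
have eQ : Q = Q'.
  have [QR _ _] := (mem_codes _ _ _).1 pC; have [QR' _ _] := (mem_codes _ _ _).1 qC.
  have := allP (allP reps_distinct _ QR) _ QR'.
  by rewrite /nilp !size_eq0 (negbTE n1) (negbTE n2) !orbF => /eqP.
by congr pair => //; apply/eqP; rewrite eqn_leq h1 // h2.
Qed.

Lemma num_classes_codes : num_classes l (size (codes l)).
Proof.
pose f (p : seq pt * nat) := polygon p.1 (hnf l p.2).
pose g i := iso_class l (f (nth ([::], 0%N) (codes l) i)).
have refl p : p \in codes l -> reflexive_polygon l (f p).
  case: p => Q c /mem_codes [QR cl /andP[vc _]].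
  exact/(reflexive_polygonP (reps_goodloop QR) l0 (mdet_hnf c)).
rewrite /num_classes; have -> : iso_classes l = [set g i | i in `I_(size (codes l))].
  apply/funext => C; apply/propext; split; last first.
    by case=> i /= il <-; exists (f (nth ([::], 0%N) (codes l) i)) => //; apply/refl/mem_nth.
  case=> P rP <-; have [Q [W [QS dW eP]]] := reflexive_loop l0 rP.
  have gQ : goodloop Q by have /andP[] := allP search_loops _ QS.
  have vW : valid Q W by apply/(reflexive_polygonP gQ l0 dW); rewrite -eP.
  have [p pC i] := code_exists QS dW vW.
  exists (index p (codes l)); first by rewrite /= index_mem.
  rewrite /g nth_index // eP; apply/funext => R; apply/propext.
  split=> -[rR iR]; split => //; first exact: isomorphic_trans i iR.
  exact: isomorphic_trans (isomorphic_sym i) iR.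
apply: inj_card_eq => i j; rewrite !inE => il jl eg.
have pi := mem_nth ([::], 0%N) il; have pj := mem_nth ([::], 0%N) jl.
(* Each class contains the polygon of its own code, so equal classes give isomorphic polygons and
   [code_inj] applies. *)
have ii : g i (f (nth ([::], 0%N) (codes l) i)).
  split; first exact: refl.
  exact: isomorphic_polygon_refl.
move: ii; rewrite eg => -[_ /code_inj].
by move/(_ pj pi)/esym/eqP; rewrite nth_uniq ?codes_uniq // => /eqP.
Qed.

End Codes.

Definition class_counts : seq (nat * nat) := [::
  (1, 16); (3, 1); (5, 12); (7, 29); (9, 1); (11, 61); (13, 81); (15, 1); (17, 113); (19, 131);
  (21, 2); (23, 163); (25, 50); (27, 2); (29, 215); (31, 233); (33, 2); (35, 34); (37, 285); (39, 3);
  (41, 317); (43, 335); (45, 2); (47, 367); (49, 182); (51, 3); (53, 419); (55, 72); (57, 4);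
  (59, 469)]%N.

Lemma size_codes : all (fun p => (0 < p.1)%N && (size (codes p.1) == p.2)) class_counts.
Proof. by vm_compute. Qed.

Lemma num_classes_count l k : (l, k) \in class_counts -> num_classes l k.
Proof.
move/(allP size_codes) => /andP[/= l0 /eqP <-].
by apply: num_classes_codes => // P; apply: reflexive_loop.
Qed.

Theorem theorem1p4 :
  num_classes 1 16 /\ num_classes 3 1 /\ num_classes 5 12 /\ num_classes 7 29 /\ num_classes 9 1 /\
  num_classes 11 61 /\ num_classes 13 81 /\ num_classes 15 1 /\ num_classes 17 113 /\ num_classes 19 131 /\
  num_classes 21 2 /\ num_classes 23 163 /\ num_classes 25 50 /\ num_classes 27 2 /\ num_classes 29 215 /\
  num_classes 31 233 /\ num_classes 33 2 /\ num_classes 35 34 /\ num_classes 37 285 /\ num_classes 39 3 /\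
  num_classes 41 317 /\ num_classes 43 335 /\ num_classes 45 2 /\ num_classes 47 367 /\ num_classes 49 182 /\
  num_classes 51 3 /\ num_classes 53 419 /\ num_classes 55 72 /\ num_classes 57 4 /\ num_classes 59 469.
Proof. by do !split; apply: num_classes_count. Qed.
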